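(* Let $T$ be the theory defined in the context, let $\mathcal{C}$ be an arbitrary model of $T$, and let $A\subseteq V^{\mathcal{C}}$. Then $A$ is a set of indiscernibles and the principal types over $A$ are dense, but there is an atomic model of $T(A)=\mathrm{Th}(\mathcal{C},a)_{a\in A}$ if and only if $|A|\le\aleph_1$.
   Context: Let $L$ be the countable language consisting of unary predicate symbols $U,V$, a unary function symbol $p$, and for each $n\in\omega$ a binary function symbol $f_n$ and a binary relation symbol $R_n$; the function symbols may be interpreted as partial functions. For a subset $X$ of an $L$-structure $M$, $cl(X)$ is the transitive closure of $cl_0(X)=\{f_n(b,c):b,c\in X,\ n\in\omega\}$ (i.e., the closure under the functions $f_n$). Let $K$ be the class of all finite $L$-structures $\mathcal{A}$ (universe $A$) such that: (i) $U$ and $V$ are disjoint and their union is $A$; (ii) $p:U\to V$; (iii) each $f_n:U\times U\to U$; (iv) $R_n(x,y)\rightarrow(U(x)\wedge U(y))$ for each $n$; (v) the family $\{R_n:n\in\omega\}$ partitions $U^2$ into disjoint pieces; (vi) for each $n$ and $m\ge n$, $R_n(x,y)\rightarrow f_m(x,y)=x$; (vii) if $x',y'\in cl(\{x,y\})$ and $R_n(x,y)$, then $\bigvee_{j\le n}R_j(x',y')$; (viii) for all $x_0,x_1,x_2\in U$ there is a permutation $\sigma$ of $\{0,1,2\}$ with $x_{\sigma(0)}\in cl(\{x_{\sigma(1)},x_{\sigma(2)}\})$. The class $K$ is closed under isomorphism and substructures, has countably many isomorphism types, and has the joint embedding and amalgamation properties; let $\mathcal{B}$ be its countable $K$-generic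 structure (the countable structure that is a union of an increasing chain of members of $K$, into which every member of $K$ embeds, and in which every isomorphism between finite substructures extends to an automorphism). Let $T=\mathrm{Th}(\mathcal{B})$. ''The principal types over $A$ are dense'' means every formula with parameters from $A$ consistent with $T(A)$ is implied by a formula with parameters from $A$ isolating a complete type of $T(A)$. An atomic model of $T(A)$ is a model in which every finite tuple realizes an isolated type of $T(A)$. *)

(* Defs.v *)
From mathcomp Require Import all_boot perm.
From mathcomp Require Import boolp wochoice classical_sets functions cardinality.

Set Implicit Arguments.
Unset Strict Implicit.
Unset Printing Implicit Defensive.

Local Open Scope classical_set_scope.
Local Open Scope card_scope.

(** * Structures for the language {U, V, p, f_n, R_n} *)

(* The function symbols are interpreted as partial functions; [None] is
   "undefined". *)
Record Lstructure := LStructure {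
  carrier :> Type;
  inU : set carrier;
  inV : set carrier;
  fp : carrier -> option carrier;
  ff : nat -> carrier -> carrier -> option carrier;
  rR : nat -> carrier -> carrier -> Prop
}.
Arguments inU : clear implicits.
Arguments inV : clear implicits.

(* Both sides of the equations for [fp] and [ff] have to be defined
   simultaneously. *)
Record embedding (M N : Lstructure) (h : M -> N) : Prop := Embedding {
  emb_inj : injective h;
  emb_U : forall x, inU N (h x) <-> inU M x;
  emb_V : forall x, inV N (h x) <-> inV M x;
  emb_fp : forall x, fp (h x) = omap h (fp x);
  emb_ff : forall n x y, ff n (h x) (h y) = omap h (ff n x y);
  emb_rR : forall n x y, rR n (h x) (h y) <-> rR n x y
}.

Definition isomorphism (M N : Lstructure) (h : M -> N) : Prop :=
  embedding h /\ bijective h.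

Definition substructure (M : Lstructure) (D : set M) : Prop :=
  (forall x y, D x -> fp x = Some y -> D y) /\
  (forall n x y z, D x -> D y -> ff n x y = Some z -> D z).

(* Only meaningful for [D] a substructure: otherwise values falling outside
   [D] become undefined. *)
Definition induced (M : Lstructure) (D : set M) : Lstructure :=
  @LStructure (set_type D)
    [set x | inU M (val x)]
    [set x | inV M (val x)]
    (fun x => obind insub (fp (val x)))
    (fun n x y => obind insub (ff n (val x) (val y)))
    (fun n x y => rR n (val x) (val y)).

Inductive cl (M : Lstructure) (X : set M) : M -> Prop :=
| cl_base x of X x : cl X x
| cl_step n b c d of cl X b & cl X c & ff n b c = Some d : cl X d.

(** * The class K *)

Record inK (M : Lstructure) : Prop := InK {
  K_finite : finite_set [set: M];
  K_disjoint : inU M `&` inV M = set0;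
  K_cover : inU M `|` inV M = [set: M];
  K_fp_total : forall (x : M), inU M x -> exists2 y, fp x = Some y & inV M y;
  K_fp_dom : forall (x y : M), fp x = Some y -> inU M x;
  K_ff_total : forall (n : nat) (x y : M), inU M x -> inU M y ->
    exists2 z, ff n x y = Some z & inU M z;
  K_ff_dom : forall (n : nat) (x y z : M),
    ff n x y = Some z -> inU M x /\ inU M y;
  K_rR_U : forall (n : nat) (x y : M), rR n x y -> inU M x /\ inU M y;
  K_rR_cover : forall (x y : M), inU M x -> inU M y -> exists n, rR n x y;
  K_rR_disjoint : forall (m n : nat) (x y : M), rR m x y -> rR n x y -> m = n;
  K_rR_ff : forall (n m : nat) (x y : M),
    n <= m -> rR n x y -> ff m x y = Some x;
  K_rR_cl : forall (n : nat) (x y x' y' : M),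
    cl [set x; y] x' -> cl [set x; y] y' ->
    rR n x y -> exists2 j, j <= n & rR j x' y';
  K_triple : forall x : 'I_3 -> M, (forall i, inU M (x i)) ->
    exists s : {perm 'I_3},
      cl [set x (s (inord 1)); x (s (inord 2))] (x (s (inord 0)))
}.

Record K_generic (B : Lstructure) : Prop := KGeneric {
  gen_countable : countable [set: B];
  gen_chain : exists D : nat -> set B,
    [/\ forall n, substructure (D n) /\ inK (induced (D n)),
        forall n, D n `<=` D n.+1
      & \bigcup_n D n = [set: B]];
  gen_universal : forall M : Lstructure, inK M ->
    exists h : M -> B, embedding h;
  gen_homogeneous : forall (X Y : set B) (g : induced X -> induced Y),
    finite_set X -> finite_set Y -> substructure X -> substructure Y ->
    isomorphism g ->
    exists2 s : B -> B, isomorphism s & forall x : X, s (val x) = val (g x)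
}.

(** * First-order logic with parameters *)

(* [formula P n] is the set of formulas with constants from [P] and free
   variables among the [n] variables indexed by ['I_n]; [formula void n] is
   the parameter-free case.  [Fall] binds the variable [ord0]. *)
Inductive term (P : Type) (n : nat) : Type :=
| Tvar of 'I_n
| Tpar of P
| Tfp of term P n
| Tff of nat & term P n & term P n.

Inductive formula (P : Type) : nat -> Type :=
| Feq n of term P n & term P n : formula P n
| FU n of term P n : formula P n
| FV n of term P n : formula P n
| FR n of nat & term P n & term P n : formula P n
| Fbot n : formula P n
| Fimp n of formula P n & formula P n : formula P n
| Fall n of formula P n.+1 : formula P n.

Definition vcons (T : Type) (n : nat) (x : T)
  (v : 'I_n -> T) (i : 'I_n.+1) : T :=
  oapp v x (unlift ord0 i).

Definition vnil (T : Type) (i : 'I_0) : T := False_rect T (notF (ltn_ord i)).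

Fixpoint eval (M : Lstructure) (P : Type) (c : P -> M) (n : nat) (v : 'I_n -> M)
    (t : term P n) : option M :=
  match t with
  | Tvar i => Some (v i)
  | Tpar a => Some (c a)
  | Tfp t => obind (@fp M) (eval c v t)
  | Tff k t u =>
      obind (fun x => obind (fun y => ff k x y) (eval c v u)) (eval c v t)
  end.

(* An atomic formula holds only if all its terms are defined. *)
Fixpoint sat (M : Lstructure) (P : Type) (c : P -> M) (n : nat)
    (phi : formula P n) : ('I_n -> M) -> Prop :=
  match phi in formula _ n return ('I_n -> M) -> Prop with
  | Feq _ t u => fun v => exists2 x, eval c v t = Some x & eval c v u = Some x
  | FU _ t => fun v => exists2 x, eval c v t = Some x & inU M x
  | FV _ t => fun v => exists2 x, eval c v t = Some x & inV M x
  | FR _ k t u => fun v => exists x y,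
      [/\ eval c v t = Some x, eval c v u = Some y & rR k x y]
  | Fbot _ => fun=> False
  | Fimp _ phi psi => fun v => sat c phi v -> sat c psi v
  | Fall _ phi => fun v => forall x, sat c phi (vcons x v)
  end.

(* Th(M, c_a)_{a in P} *)
Definition Th (M : Lstructure) (P : Type) (c : P -> M) : set (formula P 0) :=
  [set phi | sat c phi (@vnil M)].

Definition models (M : Lstructure) (P : Type) (c : P -> M)
  (Gamma : set (formula P 0)) : Prop := Gamma `<=` Th c.

Definition Th0 (M : Lstructure) : set (formula void 0) := Th (of_void M).

Definition models0 (M : Lstructure) (Gamma : set (formula void 0)) : Prop :=
  models (of_void M) Gamma.

Definition consistent_with (P : Type) (Gamma : set (formula P 0)) (n : nat)
  (phi : formula P n) : Prop :=
  exists (M : Lstructure) (c : P -> M) (v : 'I_n -> M),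
    models c Gamma /\ sat c phi v.

Definition entails (P : Type) (Gamma : set (formula P 0)) (n : nat)
  (phi psi : formula P n) : Prop :=
  forall (M : Lstructure) (c : P -> M) (v : 'I_n -> M),
    models c Gamma -> sat c phi v -> sat c psi v.

Definition tp (M : Lstructure) (P : Type) (c : P -> M) (n : nat)
  (v : 'I_n -> M) : set (formula P n) := [set phi | sat c phi v].

Definition complete_type (P : Type) (Gamma : set (formula P 0)) (n : nat)
  (q : set (formula P n)) : Prop :=
  exists (M : Lstructure) (c : P -> M) (v : 'I_n -> M),
    models c Gamma /\ q = tp c v.

Definition isolates (P : Type) (Gamma : set (formula P 0)) (n : nat)
  (phi : formula P n) (q : set (formula P n)) : Prop :=
  q phi /\ forall psi, q psi -> entails Gamma phi psi.

Definition principal_types_dense (P : Type) (Gamma : set (formula P 0)) : Prop :=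
  forall n (phi : formula P n), consistent_with Gamma phi ->
    exists psi q,
      [/\ complete_type Gamma q, isolates Gamma psi q & entails Gamma psi phi].

Definition atomic_model (P : Type) (Gamma : set (formula P 0))
  (M : Lstructure) (c : P -> M) : Prop :=
  models c Gamma /\
  forall n (v : 'I_n -> M), exists phi, isolates Gamma phi (tp c v).

(* Fully (order-free) indiscernible. *)
Definition indiscernible (M : Lstructure) (A : set M) : Prop :=
  forall n (a b : 'I_n -> A), injective a -> injective b ->
  forall phi : formula void n,
    sat (of_void M) phi (val \o a) <-> sat (of_void M) phi (val \o b).

(* T(A), for T the complete theory of [M]. *)
Definition ThA (M : Lstructure) (A : set M) : set (formula A 0) :=
  Th (fun a : A => val a).

Arguments ThA {M} A _.

(** * The cardinal aleph_1 *)

(* (W, R) has order type omega_1: an uncountable well-order with countable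
   initial segments. *)
Definition is_omega1 (W : Type) (R : rel W) : Prop :=
  [/\ well_order R, ~ countable [set: W] & forall w, countable [set v | R v w]].

Definition card_le_aleph1 (T : Type) (A : set T) : Prop :=
  exists (W : Type) (R : rel W), is_omega1 R /\ A #<= [set: W].

(* Main.v *)
Require Import Defs.
From mathcomp Require Import all_boot perm.
From mathcomp Require Import boolp wochoice classical_sets functions cardinality.

(* Call a structure rich if its finite tuples lie in copies of members of K and
   embeddings of members of K into it extend along embeddings in K.  Any two rich
   structures are related by back-and-forth, and B is rich; a finite subset of V
   is a substructure without further relations, so A is indiscernible and the
   truth of a formula over A can be tested in any rich structure, for any
   injective naming of the parameters by points of V.

   By (v) and (vi), one formula describes a copy of a finite E in K; with names
   for the points of E in V (or for all of A, if A is finite) it isolates a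
   type over A.  Hence the density, and the atomicity of a rich M together with
   a bijection from A to its V (an injection, if A is finite).  For |A| = aleph_1,
   such an M is a union of countable rich structures: adding infinitely many
   points to V of a countable one leaves a structure that embeds in B again.

   Conversely, tuples of an atomic model lie in copies of members of K, so there
   cl({x,y}) is finite and, by (viii), of three points of U one is in the closure
   of the other two.  If |U| > aleph_1, take a closed uncountable Y in U and z
   outside Y; for Y0 in Y countably infinite choose y in Y outside the countable
   union of the cl({x,z}), x in Y0, and then x in Y0 outside the finite
   cl({y,z}): the points x, y, z contradict (viii).  As p is onto V, |A| <= |U|. *)

Set Implicit Arguments.
Unset Strict Implicit.
Unset Printing Implicit Defensive.

Local Open Scope classical_set_scope.
Local Open Scope card_scope.

(** * Formulas and substitution *)

Definition vcat (T : Type) m n (u : 'I_m -> T) (v : 'I_n -> T) (i : 'I_(m + n)) : T :=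
  match fintype.split i with inl a => u a | inr b => v b end.

Lemma vcat_lshift (T : Type) m n (u : 'I_m -> T) (v : 'I_n -> T) i :
  vcat u v (lshift n i) = u i.
Proof. by rewrite /vcat (unsplitK (inl i)). Qed.

Lemma vcat_rshift (T : Type) m n (u : 'I_m -> T) (v : 'I_n -> T) i :
  vcat u v (rshift m i) = v i.
Proof. by rewrite /vcat (unsplitK (inr i)). Qed.

Lemma vcons0 (T : Type) n x (v : 'I_n -> T) : vcons x v ord0 = x.
Proof. by rewrite /vcons unlift_none. Qed.

Lemma vconsS (T : Type) n x (v : 'I_n -> T) i : vcons x v (lift ord0 i) = v i.
Proof. by rewrite /vcons liftK. Qed.

Lemma vcons_eta (T : Type) n (v : 'I_n.+1 -> T) :
  vcons (v ord0) (v \o lift ord0) = v.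
Proof.
apply/funext => i; case: (unliftP ord0 i) => [j ->|->]; first by rewrite vconsS.
by rewrite vcons0.
Qed.

Lemma vcons_comp (S T : Type) n (f : S -> T) x (v : 'I_n -> S) :
  f \o vcons x v = vcons (f x) (f \o v).
Proof.
apply/funext => i; case: (unliftP ord0 i) => [j ->|->] /=; first by rewrite !vconsS.
by rewrite !vcons0.
Qed.

Lemma vcons_vcat (T : Type) m n x (u : 'I_m -> T) (v : 'I_n -> T) :
  vcons x (vcat u v) = vcat (vcons x u) v :> ('I_(m + n).+1 -> T).
Proof.
apply/funext => i; case: (unliftP ord0 i) => [j ->|->].
  rewrite vconsS; case: (split_ordP j) => k ->.
    have -> : lift ord0 (lshift n k) = lshift n (lift ord0 k) by apply/val_inj.
    by rewrite !vcat_lshift vconsS.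
  have -> : lift ord0 (rshift m k) = @rshift m.+1 n k by apply/val_inj.
  by rewrite !vcat_rshift.
have {2}-> : ord0 = lshift n (@ord0 m) by apply/val_inj.
by rewrite vcat_lshift !vcons0.
Qed.

Lemma vnil_eq (T : Type) (u v : 'I_0 -> T) : u = v.
Proof. by apply/funext => -[]. Qed.

Section Connectives.
Variables (P : Type) (n : nat).
Implicit Types phi psi : formula P n.

Definition Fnot phi := Fimp phi (Fbot P n).
Definition Fand phi psi := Fnot (Fimp phi (Fnot psi)).
Definition Fands (I : finType) (F : I -> formula P n) :=
  foldr Fand (Fnot (Fbot P n)) [seq F i | i <- enum I].
(** Carries into a formula a fact decided outside the logic: a false [Q] contributes a trivially
    true conjunct. *)
Definition Fguard (Q : Prop) phi := if `[<Q>] then phi else Fnot (Fbot P n).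
Definition Fex (phi : formula P n.+1) : formula P n :=
  Fnot (Fall (Fimp phi (Fbot P n.+1))).

Variables (M : Lstructure) (c : P -> M) (v : 'I_n -> M).

Lemma sat_not phi : sat c (Fnot phi) v <-> ~ sat c phi v. Proof. by []. Qed.

Lemma sat_and phi psi : sat c (Fand phi psi) v <-> sat c phi v /\ sat c psi v.
Proof.
split=> [H|[a b] /(_ a)/(_ b)//].
by apply: contrapT => nab; apply: H => a b; apply: nab.
Qed.

Lemma sat_ands (I : finType) F :
  sat c (@Fands I F) v <-> forall i, sat c (F i) v.
Proof.
have -> : (forall i, sat c (F i) v) <-> forall i, i \in enum I -> sat c (F i) v.
  by split => H i; [move=> _; exact: H | apply: H; rewrite mem_enum].
rewrite /Fands; elim: (enum I) => [|i s IH]; first by split => // _ [].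
rewrite [foldr _ _ _]/= sat_and IH; split.
  by move=> [Hi Hs] j; rewrite inE => /predU1P[->//|/Hs].
by move=> H; split=> [|j js]; apply: H; rewrite inE ?eqxx ?js ?orbT.
Qed.

Lemma sat_guard (Q : Prop) phi : sat c (Fguard Q phi) v <-> (Q -> sat c phi v).
Proof.
by rewrite /Fguard; case: asboolP => q; split=> H //; exact: H.
Qed.

Lemma sat_ex (phi : formula P n.+1) :
  sat c (Fex phi) v <-> exists x, sat c phi (vcons x v).
Proof.
by split=> [/= /existsNP[x /= /contrapT]|[x]] H; [exists x | move/(_ x)/(_ H)].
Qed.

End Connectives.

Section AtomicFormulas.
Variables (P : Type) (M : Lstructure) (c : P -> M) (n : nat) (v : 'I_n -> M).

Lemma sat_imp phi psi : sat c (Fimp phi psi) v <-> (sat c phi v -> sat c psi v).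
Proof. by []. Qed.

Lemma sat_eqvar i j : sat c (Feq (Tvar _ i) (Tvar _ j)) v <-> v i = v j.
Proof. by split=> [[x /= [->] [->]]|/= ->] //; exists (v j). Qed.

Lemma sat_U i : sat c (FU (Tvar _ i)) v <-> inU M (v i).
Proof. by split=> [[x /= [->]]|] //; exists (v i). Qed.

Lemma sat_V i : sat c (FV (Tvar _ i)) v <-> inV M (v i).
Proof. by split=> [[x /= [->]]|] //; exists (v i). Qed.

Lemma sat_R k i j : sat c (FR k (Tvar _ i) (Tvar _ j)) v <-> rR k (v i) (v j).
Proof. by split=> [[x [y /= [[->] [->]]]]|r] //; exists (v i), (v j). Qed.

Lemma sat_fp i j :
  sat c (Feq (Tfp (Tvar _ i)) (Tvar _ j)) v <-> fp (v i) = Some (v j).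
Proof. by split=> [[x /= -> [->]]|e] //; exists (v j). Qed.

Lemma sat_ff k i j l :
  sat c (Feq (Tff k (Tvar _ i) (Tvar _ j)) (Tvar _ l)) v <->
  ff k (v i) (v j) = Some (v l).
Proof. by split=> [[x /= -> [->]]|e] //; exists (v l). Qed.

End AtomicFormulas.

(** Theories contain only sentences, so validity of a formula at all tuples passes between
    structures through this closure. *)
Fixpoint closeall (P : Type) n : formula P n -> formula P 0 :=
  match n with
  | 0 => id
  | n'.+1 => fun phi => closeall (Fall phi)
  end.

Lemma sat_closeall (P : Type) (M : Lstructure) (c : P -> M) n (phi : formula P n) :
  sat c (closeall phi) (@vnil M) <-> forall v, sat c phi v.
Proof.
elim: n phi => [|n IH] phi /=; first by split => // H v; rewrite (vnil_eq v (@vnil M)).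
by rewrite IH; split => H v => [|x]; [rewrite -(vcons_eta v); exact: H | exact: H].
Qed.

Fixpoint Fexs (P : Type) m n : formula P (m + n) -> formula P n :=
  match m return formula P (m + n) -> formula P n with
  | 0 => id
  | m'.+1 => fun phi => @Fexs P m' n (@Fex P (m' + n) phi)
  end.
Arguments Fexs {P} m n _.

Lemma sat_Fexs (P : Type) (M : Lstructure) (c : P -> M) m n
    (phi : formula P (m + n)) v :
  sat c (Fexs m n phi) v <-> exists u, sat c phi (vcat u v).
Proof.
elim: m phi => [|m IH] phi.
  have E u : @vcat M 0 n u v = v.
    by apply/funext => i; rewrite -{1}[i](_ : rshift 0 i = i) ?vcat_rshift//;
      apply/val_inj.
  split=> [H|[u]]; first by exists (@vnil M); rewrite E.
  by rewrite E.
rewrite [Fexs _ _ _]/= IH; split=> [[u /sat_ex[x]]|[u]].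
  by rewrite vcons_vcat; exists (vcons x u).
rewrite -(vcons_eta u) -vcons_vcat => H; exists (u \o lift ord0).
by apply/sat_ex; exists (u ord0).
Qed.

(** * Simultaneous renaming of variables and parameters *)

Section Renaming.
Variables P Q : Type.

Definition tleaf m (x : 'I_m + Q) : term Q m :=
  match x with inl i => Tvar Q i | inr q => Tpar m q end.

Fixpoint tren n m (s : 'I_n -> 'I_m + Q) (r : P -> 'I_m + Q) (t : term P n) : term Q m :=
  match t with
  | Tvar i => tleaf (s i)
  | Tpar a => tleaf (r a)
  | Tfp t => Tfp (tren s r t)
  | Tff k t u => Tff k (tren s r t) (tren s r u)
  end.

Definition lshiftS m (x : 'I_m + Q) : 'I_m.+1 + Q :=
  match x with inl i => inl (lift ord0 i) | inr q => inr q end.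

(** Parameters may become variables; this turns a sentence over [A] into a parameter-free formula
    evaluated at a tuple. Under a quantifier [ord0] is kept and all old targets are shifted. *)
Fixpoint ren n (phi : formula P n) :
    forall m, ('I_n -> 'I_m + Q) -> (P -> 'I_m + Q) -> formula Q m :=
  match phi in formula _ n
  return forall m, ('I_n -> 'I_m + Q) -> (P -> 'I_m + Q) -> formula Q m with
  | Feq _ t u => fun m s r => Feq (tren s r t) (tren s r u)
  | FU _ t => fun m s r => FU (tren s r t)
  | FV _ t => fun m s r => FV (tren s r t)
  | FR _ k t u => fun m s r => FR k (tren s r t) (tren s r u)
  | Fbot _ => fun m s r => Fbot Q m
  | Fimp _ phi psi => fun m s r => Fimp (ren phi s r) (ren psi s r)
  | Fall _ phi => fun m s r =>
      Fall (ren phi (vcons (inl ord0) (@lshiftS m \o s)) (@lshiftS m \o r))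
  end.

Variables (M : Lstructure) (c : Q -> M).

Definition leafval m (v : 'I_m -> M) (x : 'I_m + Q) : M :=
  match x with inl i => v i | inr q => c q end.

Lemma eval_tren n m (s : 'I_n -> 'I_m + Q) r (t : term P n) (v : 'I_m -> M) :
  eval c v (tren s r t) = eval (leafval v \o r) (leafval v \o s) t.
Proof.
elim: t => [i|a|t /= ->|k t /= -> u ->] //=.
  by case: (s i).
by case: (r a).
Qed.

Lemma leafvalS m (v : 'I_m -> M) x : leafval (vcons x v) \o @lshiftS m = leafval v.
Proof. by apply/funext => -[i|q] //=; rewrite vconsS. Qed.

Lemma sat_ren n (phi : formula P n) m (s : 'I_n -> 'I_m + Q) r (v : 'I_m -> M) :
  sat c (ren phi s r) v <-> sat (leafval v \o r) phi (leafval v \o s).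
Proof.
elim: phi m s r v => {n}[n t u|n t|n t|n k t u|n|n phi IH psi IH2|n phi IH] m s r v /=.
- by rewrite !eval_tren.
- by rewrite !eval_tren.
- by rewrite !eval_tren.
- by rewrite !eval_tren.
- by [].
- by rewrite IH IH2.
- have E x : leafval (vcons x v) \o vcons (inl ord0) (@lshiftS m \o s)
             = vcons x (leafval v \o s).
    rewrite vcons_comp /= vcons0; congr vcons.
    by rewrite compA leafvalS.
  have F x : leafval (vcons x v) \o (@lshiftS m \o r) = leafval v \o r.
    by rewrite compA leafvalS.
  by split=> H x; have := H x; rewrite IH E F.
Qed.

End Renaming.

(** * Dependence of a formula on its finitely many parameters *)

Section Params.
Variable P : Type.

Fixpoint tparams n (t : term P n) : set P :=
  match t with
  | Tvar _ => set0
  | Tpar a => [set a]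
  | Tfp t => tparams t
  | Tff _ t u => tparams t `|` tparams u
  end.

Fixpoint params n (phi : formula P n) : set P :=
  match phi with
  | Feq _ t u => tparams t `|` tparams u
  | FU _ t => tparams t
  | FV _ t => tparams t
  | FR _ _ t u => tparams t `|` tparams u
  | Fbot _ => set0
  | Fimp _ phi psi => params phi `|` params psi
  | Fall _ phi => params phi
  end.

Lemma finite_tparams n (t : term P n) : finite_set (tparams t).
Proof.
by elim: t => /= [i|a|//|k t Ht u Hu]; rewrite ?finite_setU.
Qed.

Lemma finite_params n (phi : formula P n) : finite_set (params phi).
Proof.
elim: phi => {n}[n t u|n t|n t|n k t u|n|n phi IH psi IH2|n phi IH] //=;
  rewrite ?finite_setU; do ?split => //; exact: finite_tparams.
Qed.

Lemma eval_eq_params (M : Lstructure) (c c' : P -> M) n (v : 'I_n -> M) t :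
  (forall a, tparams t a -> c a = c' a) -> eval c v t = eval c' v t.
Proof.
elim: t => /= [i|a|t IH|k t IH u IHu] H //.
- by rewrite H.
- by rewrite IH.
- by rewrite IH ?IHu // => a Ha; apply: H; [right|left].
Qed.

Lemma sat_eq_params (M : Lstructure) (c c' : P -> M) n (phi : formula P n) v :
  (forall a, params phi a -> c a = c' a) -> sat c phi v <-> sat c' phi v.
Proof.
elim: phi v => {n}[n t u|n t|n t|n k t u|n|n phi IH psi IH2|n phi IH] v /= H //;
  rewrite -?(@eval_eq_params _ c c' _ v t) -?(@eval_eq_params _ c c' _ v u) //;
  try by move=> a Ha; apply: H; by [|left|right].
- by rewrite IH ?IH2 // => a Ha; apply: H; [right|left].
- by split=> K x; have := K x; rewrite IH.
Qed.

End Params.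

Lemma finite_enum (T : Type) (S : set T) : finite_set S ->
  exists m (a : 'I_m -> T), range a = S.
Proof.
move=> /finite_setP[m] /card_bijP[f [g fK gK]].
have [m0|m0] := posnP m.
  exists 0, (@vnil T); apply/seteqP; split=> [x [[]]//|x Sx].
  have H k : `I_m k -> False by rewrite m0.
  by case: (H _ (set_valP (f (SigSub (mem_set Sx))))).
have lt (i : 'I_m) : (i : nat) \in `I_m by apply: mem_set; exact: ltn_ord.
exists m, (fun i => val (g (SigSub (lt i)))).
apply/seteqP; split=> [x [i _ <-]|x Sx]; first exact: set_valP.
pose y : S := SigSub (mem_set Sx); have fy := set_valP (f y).
exists (Ordinal fy) => //; rewrite -[RHS]/(val y) -[in RHS](fK y).
by congr (val (g _)); apply/val_inj.
Qed.

Lemma finite_setT_type (T : Type) (S : set T) : finite_set S -> finite_set [set: S].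
Proof. by rewrite (eq_finite_set (card_setT S)). Qed.

(** * Rich structures *)

(** Structures built later on a fixed carrier have points outside both predicates. Such points count
    as absent, which is why [locK] speaks only of tuples from the support. *)
Definition supp (M : Lstructure) : set M := inU M `|` inV M.

Definition full (M : Lstructure) : Prop := forall x : M, supp x.

Definition locK (M : Lstructure) : Prop :=
  forall n (v : 'I_n -> M), (forall i, supp (v i)) ->
  exists (E : Lstructure) (h : E -> M),
    [/\ inK E, embedding h & forall i, exists z, h z = v i].

Definition extK (M : Lstructure) : Prop :=
  forall (E F : Lstructure) (i : E -> F) (k : E -> M),
    inK E -> inK F -> embedding i -> embedding k ->
  exists2 k' : F -> M, embedding k' & forall x, k' (i x) = k x.

Record rich (M : Lstructure) : Prop := Rich {
  rich_full : full M; rich_loc : locK M; rich_ext : extK M }.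

Lemma omap_inj (S T : Type) (f : S -> T) : injective f -> injective (omap f).
Proof. by move=> fI [x|] [y|] //= [] /fI->. Qed.

Lemma embedding_comp (M N Q : Lstructure) (g : N -> Q) (h : M -> N) :
  embedding g -> embedding h -> embedding (g \o h).
Proof.
move=> [gI gU gV gp gf gR] [hI hU hV hp hf hR]; split => /=.
- exact: inj_comp.
- by move=> x; rewrite gU.
- by move=> x; rewrite gV.
- by move=> x; rewrite gp hp; case: (fp x).
- by move=> n x y; rewrite gf hf; case: (ff n x y).
- by move=> n x y; rewrite gR.
Qed.

Lemma embedding_left (M N Q : Lstructure) (g : N -> Q) (h : M -> N) :
  embedding g -> embedding (g \o h) -> embedding h.
Proof.
move=> [gI gU gV gp gf gR] [hI hU hV hp hf hR]; split => /=.
- exact: inj_compr hI.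
- by move=> x; rewrite -gU hU.
- by move=> x; rewrite -gV hV.
- move=> x; apply: (omap_inj gI); rewrite -gp -[g (h x)]/((g \o h) x) hp.
  by case: (fp x).
- move=> n x y; apply: (omap_inj gI); rewrite -gf.
  by rewrite -[g (h x)]/((g \o h) x) -[g (h y)]/((g \o h) y) hf; case: (ff n x y).
- by move=> n x y; rewrite -gR hR.
Qed.

Lemma embedding_factor (E F M : Lstructure) (h : E -> M) (h' : F -> M) :
  embedding h -> embedding h' -> (forall x, exists y, h' y = h x) ->
  exists2 i : E -> F, embedding i & forall x, h' (i x) = h x.
Proof.
move=> hE hF /choice[i ih]; exists i => //.
by apply: embedding_left hF _; rewrite (_ : h' \o i = h) //; apply/funext.
Qed.

Lemma K_full (E : Lstructure) : inK E -> full E.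
Proof. by move=> EK x; rewrite /supp (K_cover EK). Qed.

Lemma K_notUV (E : Lstructure) : inK E -> forall x : E, inU E x -> inV E x -> False.
Proof. by move=> EK x xU xV; have : (inU E `&` inV E) x by []; rewrite K_disjoint. Qed.

Lemma embedding_supp (E M : Lstructure) (h : E -> M) : embedding h ->
  forall x, supp (h x) <-> supp x.
Proof. by move=> hE x; rewrite /supp /setU/= (emb_U hE) (emb_V hE). Qed.

Lemma K_enum (E : Lstructure) : inK E ->
  exists k (e : 'I_k -> E), forall x, exists i, e i = x.
Proof.
move=> EK; have [k [e eE]] := finite_enum (K_finite EK); exists k, e => x.
by have : range e x by [rewrite eE]; case=> i _ <-; exists i.
Qed.

(** * Back-and-forth between rich structures *)

Section BackAndForth.

(** A pair of embeddings of one [E] plays the part of a finite partial isomorphism. Applying [locK]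
    to [x] together with the points of [h(E)] gives a larger member of K inside [M], and [extK]
    extends [k] to it. *)
Lemma forth (M N E : Lstructure) (h : E -> M) (k : E -> N) (x : M) :
  locK M -> extK N -> inK E -> embedding h -> embedding k -> supp x ->
  exists (F : Lstructure) (h' : F -> M) (k' : F -> N) (i : E -> F),
    [/\ inK F, embedding h' /\ embedding k', exists z, h' z = x,
        forall y, h' (i y) = h y & forall y, k' (i y) = k y].
Proof.
move=> ML NX EK hE kE xs; have [m [e eE]] := K_enum EK.
have [|F [h' [FK h'E cov]]] := ML _ (vcons x (h \o e)).
  move=> i; case: (unliftP ord0 i) => [j ->|->]; last by rewrite vcons0.
  by rewrite vconsS; apply/(embedding_supp hE); exact: K_full.
have [i iE ih] : exists2 i : E -> F, embedding i & forall x, h' (i x) = h x.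
  apply: embedding_factor => // y; have [j <-] := eE y.
  by have [z] := cov (lift ord0 j); rewrite vconsS => hz; exists z.
have [k' k'E k'i] := NX _ _ _ _ EK FK iE kE.
exists F, h', k', i; split=> //.
by have [z] := cov ord0; rewrite vcons0; exists z.
Qed.

Variables (P : Type) (M N : Lstructure) (c : P -> M) (d : P -> N).
Hypotheses (rM : rich M) (rN : rich N).

(** Embeddings preserve definedness and undefinedness, so a term has one value inside [E], possibly
    undefined, whose two images are its values in [M] and [N]. *)
Lemma eval_match n (t : term P n) (E : Lstructure) (h : E -> M) (k : E -> N) v w :
  embedding h -> embedding k ->
  (forall a, tparams t a -> exists z, h z = c a /\ k z = d a) ->
  (forall i, exists z, h z = v i /\ k z = w i) ->
  exists o, eval c v t = omap h o /\ eval d w t = omap k o.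
Proof.
move=> hE kE + vw; elim: t => [i|a|t IH|j t IH u IHu] /= H.
- by have [z [<- <-]] := vw i; exists (Some z).
- by have [//|z [<- <-]] := H a; exists (Some z).
- have [[z|] [-> ->]] := IH H; last by exists None.
  by exists (fp z) => /=; rewrite (emb_fp hE) (emb_fp kE).
- have [a Ha|o [-> ->]] := IH; first by apply: H; left.
  have [a Ha|o' [-> ->]] := IHu; first by apply: H; right.
  case: o o' => [z|] [z'|] /=; try by exists None.
  by exists (ff j z z'); rewrite (emb_ff hE) (emb_ff kE).
Qed.

(** Atomic formulas are decided inside [E], and at a quantifier [forth] enlarges [E] by the new
    point. Only parameters that occur in [phi] have to come from [E], so [E] can stay finite when
    [P] is infinite. *)
Lemma sat_match n (phi : formula P n) (E : Lstructure) (h : E -> M) (k : E -> N) v w :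
  inK E -> embedding h -> embedding k ->
  (forall a, params phi a -> exists z, h z = c a /\ k z = d a) ->
  (forall i, exists z, h z = v i /\ k z = w i) ->
  sat c phi v <-> sat d phi w.
Proof.
elim: phi E h k v w => {n}[n t u|n t|n t|n l t u|n|n phi IH psi IH2|n phi IH]
  E h k v w EK hE kE H vw //=.
- have [a Ha|o [-> ->]] := eval_match hE kE _ vw (t := t); first by apply: H; left.
  have [a Ha|o' [-> ->]] := eval_match hE kE _ vw (t := u); first by apply: H; right.
  split=> -[y]; case: o o' => [z|] [z'|] //= [<-] [].
    by move/(emb_inj hE) ->; exists (k z).
  by move/(emb_inj kE) ->; exists (h z).
- have [a Ha|o [-> ->]] := eval_match hE kE _ vw (t := t); first by apply: H.
  split=> -[y]; case: o => [z|] //= [<-]; rewrite ?(emb_U hE) ?(emb_U kE) => zU.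
    by exists (k z); rewrite ?(emb_U kE).
  by exists (h z); rewrite ?(emb_U hE).
- have [a Ha|o [-> ->]] := eval_match hE kE _ vw (t := t); first by apply: H.
  split=> -[y]; case: o => [z|] //= [<-]; rewrite ?(emb_V hE) ?(emb_V kE) => zU.
    by exists (k z); rewrite ?(emb_V kE).
  by exists (h z); rewrite ?(emb_V hE).
- have [a Ha|o [-> ->]] := eval_match hE kE _ vw (t := t); first by apply: H; left.
  have [a Ha|o' [-> ->]] := eval_match hE kE _ vw (t := u); first by apply: H; right.
  split=> -[x [y]]; case: o o' => [z|] [z'|] [] //= [<-] [<-].
    by rewrite (emb_rR hE) => r; exists (k z), (k z'); split=> //; apply/(emb_rR kE).
  by rewrite (emb_rR kE) => r; exists (h z), (h z'); split=> //; apply/(emb_rR hE).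
- rewrite (IH E h k v w) ?(IH2 E h k v w)// => a Ha; apply: H; by [left|right].
- split=> S x.
    have [F [h' [k' [i [FK [h'E k'E] [z zx] h'i k'i]]]]] :=
      forth (rich_loc rN) (rich_ext rM) EK kE hE (rich_full rN x).
    apply: (iffLR (IH F k' h' (vcons (k' z) v) _ FK k'E h'E _ _)); last exact: S.
      by move=> a /H[y [<- <-]]; exists (i y).
    move=> j; case: (unliftP ord0 j) => [l ->|->].
      by rewrite !vconsS; have [y [<- <-]] := vw l; exists (i y).
    by rewrite !vcons0; exists z.
  have [F [h' [k' [i [FK [h'E k'E] [z zx] h'i k'i]]]]] :=
    forth (rich_loc rM) (rich_ext rN) EK hE kE (rich_full rM x).
  apply: (iffRL (IH F h' k' _ (vcons (k' z) w) FK h'E k'E _ _)); last exact: S.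
    by move=> a /H[y [<- <-]]; exists (i y).
  move=> j; case: (unliftP ord0 j) => [l ->|->].
    by rewrite !vconsS; have [y [<- <-]] := vw l; exists (i y).
  by rewrite !vcons0; exists z.
Qed.

End BackAndForth.

(** * Substructures, and richness of the generic structure *)

Lemma embedding_val (M : Lstructure) (D : set M) :
  substructure D -> embedding (val : induced D -> M).
Proof.
move=> [Dp Df]; split=> //.
- move=> x /=; case E: (fp (val x)) => [y|] //=.
  have yD : y \in D by apply/mem_set/(Dp _ _ (set_valP x) E).
  by rewrite insubT.
- move=> n x y /=; case E: (ff n (val x) (val y)) => [z|] //=.
  have zD : z \in D by apply/mem_set/(Df _ _ _ _ (set_valP x) (set_valP y) E).
  by rewrite insubT.
Qed.

Lemma substructure_range (E M : Lstructure) (h : E -> M) :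
  embedding h -> substructure (range h).
Proof.
move=> hE; split=> [_ y [x _ <-]|n _ _ y [x _ <-] [x' _ <-]].
  by rewrite (emb_fp hE); case: (fp x) => //= z [<-]; exists z.
by rewrite (emb_ff hE); case: (ff n x x') => //= z [<-]; exists z.
Qed.

Lemma induced_range (E M : Lstructure) (h : E -> M) : embedding h ->
  exists2 r : E -> induced (range h), isomorphism r & forall x, val (r x) = h x.
Proof.
move=> hE; pose r x : induced (range h) := SigSub (mem_set (imageT h x)).
exists r => //; have rE : embedding r.
  apply: (embedding_left (embedding_val (substructure_range hE))).
  by rewrite (_ : val \o r = h).
split=> //.
have /choice[g rg] : forall y : induced (range h), exists x, r x = y.
  by move=> y; have [x _ hx] := set_valP y; exists x; apply/val_inj.
by exists g => // x; apply: (emb_inj rE).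
Qed.

Lemma isomorphism_inv (M N : Lstructure) (h : M -> N) (g : N -> M) :
  embedding h -> cancel g h -> embedding g.
Proof.
move=> hE gK; apply: (embedding_left hE).
rewrite (_ : h \o g = id); last exact/funext.
split=> //= [x|n x y]; by [case: fp|case: ff].
Qed.

(** A finite tuple lies in one member of the chain. For the extension property, [F] is embedded by
    some [h]; the images of [E] under [h \o i] and under [k] are isomorphic finite substructures,
    and the automorphism [t] moving the first onto the second turns [h] into the extension of
    [k]. *)
Lemma generic_rich (B : Lstructure) : K_generic B -> rich B.
Proof.
move=> GB; have [D [DK Dmono Dcov]] := gen_chain GB.
have Dm m n : m <= n -> D m `<=` D n.
  by move=> /subnK <-; elim: (n - m) => //= k IH; exact: subset_trans IH (Dmono _).
split.
- move=> x; have [n _ Dx] : (\bigcup_n D n) x by rewrite Dcov.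
  exact: (K_full (DK n).2 (SigSub (mem_set Dx))).
- move=> n v _.
  have /choice[k kD] : forall i, exists k, D k (v i).
    by move=> i; have [k _ Dx] : (\bigcup_n D n) (v i) by [rewrite Dcov]; exists k.
  pose N := \max_(i < n) k i; have [DN KN] := DK N.
  exists (induced (D N)), val; split=> //; first exact: embedding_val.
  move=> i; have vD : D N (v i) by apply: Dm (kD i); exact: leq_bigmax.
  by exists (SigSub (mem_set vD)).
- move=> E F i k EK FK iE kE; have [h hE] := gen_universal GB FK.
  have hiE := embedding_comp hE iE.
  have [r [rE [r' rK r'K]] rv] := induced_range hiE.
  have [s [sE [s' sK s'K]] sv] := induced_range kE.
  have fin (f : E -> B) : finite_set (range f) by apply/finite_image/K_finite.
  have [||||| t [tE [t' tK t'K]] tv] := @gen_homogeneous _ GB _ _ (s \o r');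
    try exact: fin; try exact: substructure_range.
    split; last by exists (r \o s') => x /=; rewrite ?sK ?rK ?r'K ?s'K.
    by apply: embedding_comp sE _; exact: isomorphism_inv r'K.
  exists (t \o h); first exact: embedding_comp.
  by move=> x; rewrite -sv -[in RHS](rK x) -tv rv.
Qed.

(** The points of [J] are put into V, with no point of U above them under p. They serve as
    parameters outside a given copy, and as room for further growth. *)
Definition addV (E : Lstructure) (J : Type) : Lstructure :=
  @LStructure (E + J)
    [set x | if x is inl y then inU E y else False]
    [set x | if x is inl y then inV E y else True]
    (fun x => if x is inl y then omap inl (fp y) else None)
    (fun n x y => match x, y with
       | inl x, inl y => omap inl (ff n x y) | _, _ => None end)
    (fun n x y => match x, y with
       | inl x, inl y => rR n x y | _, _ => False end).

Lemma embedding_addV (E : Lstructure) (J : Type) : embedding (inl : E -> addV E J).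
Proof. by split=> //= x y [->]. Qed.

Lemma cl_sub (M : Lstructure) (X Y : set M) x : X `<=` Y -> cl X x -> cl Y x.
Proof.
move=> XY; elim=> {x}[x /XY|n b c d _ bY _ cY e]; first exact: cl_base.
exact: cl_step e.
Qed.

Section EmbeddingClosure.
Variables (E M : Lstructure) (h : E -> M).
Hypothesis hE : embedding h.

Lemma cl_embedding X x : cl X x -> cl (h @` X) (h x).
Proof.
elim=> {x}[x Xx|n b c d _ hb _ hc e]; first by apply: cl_base; exists x.
by apply: cl_step hb hc (_ : ff n _ _ = _); rewrite (emb_ff hE) e.
Qed.

Lemma cl_image X y : cl (h @` X) y -> exists2 x, h x = y & cl X x.
Proof.
elim=> {y}[_ [x Xx <-]|n _ _ d _ [b <- hb] _ [c <- hc]].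
  by exists x => //; exact: cl_base.
rewrite (emb_ff hE); case e: (ff n b c) => [z|] //= [<-].
by exists z => //; exact: cl_step e.
Qed.

Lemma cl_embedding2 x y z : cl [set x; y] z -> cl [set h x; h y] (h z).
Proof. by move=> /cl_embedding; rewrite image_setU !image_set1. Qed.

Lemma cl_image2 x y z :
  cl [set h x; h y] z -> exists2 w, h w = z & cl [set x; y] w.
Proof. by move=> H; apply: cl_image; rewrite image_setU !image_set1. Qed.

End EmbeddingClosure.

Lemma inK_addV (E : Lstructure) (J : Type) :
  inK E -> finite_set [set: J] -> inK (addV E J).
Proof.
move=> EK Jfin; have iE := embedding_addV E J; split.
- have -> : [set: addV E J] = range inl `|` range inr.
    by apply/seteqP; split=> // -[x|x] _; [left; exists x|right; exists x].
  by rewrite finite_setU; split; apply: finite_image => //; exact: K_finite.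
- apply/seteqP; split=> // -[x|x] [] //=; exact: K_notUV.
- apply/seteqP; split=> // -[x|x] _; [exact: (K_full EK)|by right].
- by move=> [x|x] //= /(K_fp_total EK)[y -> yV]; exists (inl y).
- move=> [x|x] //= y; case e: (fp x) => [z|] // _; exact: (K_fp_dom EK e).
- by move=> n [x|x] [y|y] //= xU yU; have [z -> zU] := K_ff_total EK n xU yU;
    exists (inl z).
- move=> n [x|x] [y|y] //= z; case e: (ff n x y) => [w|] // _; exact: (K_ff_dom EK e).
- by move=> n [x|x] [y|y] //= /(K_rR_U EK).
- by move=> [x|x] [y|y] //= xU yU; have [n] := K_rR_cover EK xU yU; exists n.
- by move=> m n [x|x] [y|y] //=; exact: (K_rR_disjoint EK).
- by move=> n m [x|x] [y|y] //= le /(K_rR_ff EK le) ->.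
- move=> n [x|x] [y|y] // x' y' /(cl_image2 iE)[u <- xu] /(cl_image2 iE)[w <- yw] /=.
  exact: (K_rR_cl EK).
- move=> x xU.
  have /choice[y yx] : forall i, exists y, x i = inl y.
    by move=> i; case: (x i) (xU i) => // y _; exists y.
  have [|s Hs] := K_triple EK (x := y); first by move=> i; move: (xU i); rewrite yx.
  by exists s; rewrite !yx; exact: (cl_embedding2 iE).
Qed.

Definition emptyL : Lstructure :=
  @LStructure void set0 set0 (fun=> None) (fun _ _ _ => None) (fun _ _ _ => False).

Lemma inK_empty : inK emptyL.
Proof.
have H (A B : set emptyL) : A = B by apply/seteqP; split=> -[].
split; try by move=> [].
- by rewrite (H setT set0).
- exact: H.
- exact: H.
- by move=> x; case: (x ord0).
Qed.

Lemma embedding_empty (M : Lstructure) : embedding (fun x : emptyL => of_void M x).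
Proof. by split=> [[]|[]|[]|[]|n []|n []]. Qed.

(** One point [true] of U with p-value the point [false] of V. Extending from the bare point [false]
    to this structure shows that p is onto V in rich structures. *)
Definition overpoint : Lstructure :=
  @LStructure bool [set x | x] [set x | ~~ x]
    (fun x => if x then Some false else None)
    (fun n x y => if x && y then Some true else None)
    (fun n x y => [/\ n = 0, x & y]).

Lemma inK_overpoint : inK overpoint.
Proof.
split.
- exact: finite_finset.
- by apply/seteqP; split=> // -[] [].
- by apply/seteqP; split=> // -[] _; [left|right].
- by move=> [] // _; exists false.
- by move=> [].
- by move=> n [] [] // _ _; exists true.
- by move=> n [] [].
- by move=> n [] [] [].
- by move=> [] [] // _ _; exists 0.
- by move=> m n x y [-> _ _] [-> _ _].
- by move=> n m x y _ [_ ]; rewrite /= => -> ->.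
- have clU (x y z : overpoint) : x -> y -> cl [set x; y] z -> z.
    move=> hx hy; elim=> {z}[z [->|->]//|n b c d _ hb _ hc].
    by case: b c hb hc => [] [] //= _ _ [<-].
  move=> n x y x' y' cx cy [_ hx hy]; exists 0 => //.
  by split=> //; [exact: clU cx|exact: clU cy].
- move=> x xU; exists 1%g; apply: cl_base; left.
  by apply: (@eq_trans _ _ true); [exact: xU|apply/esym/xU].
Qed.

(** * The predicate V in rich structures *)

Section RichV.
Variables (M : Lstructure).
Hypothesis rM : rich M.

Lemma rich_embed (F : Lstructure) : inK F -> exists h : F -> M, embedding h.
Proof.
move=> FK; have [h hE _] :=
  rich_ext rM inK_empty FK (embedding_empty F) (embedding_empty M).
by exists h.
Qed.

Lemma rich_infiniteV : infinite_set (inV M).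
Proof.
move=> /finite_setP[n nV].
have [|h hE] := rich_embed (inK_addV (J := 'I_n.+1) inK_empty _).
  exact: finite_finset.
have : range (h \o inr) `<=` inV M.
  by move=> _ [i _ <-]; apply/(emb_V hE).
move=> /subset_card_le; rewrite (card_le_eqr nV).
have hI : injective (h \o inr) by move=> i j /(emb_inj hE)[].
rewrite (card_le_eql (inj_card_eq (in2W hI))).
by rewrite -(card_le_eql (@card_II n.+1)) card_le_II ltnn.
Qed.

Lemma rich_fp_onto (y : M) : inV M y -> exists2 x, inU M x & fp x = Some y.
Proof.
move=> yV; pose E := addV emptyL unit.
have EK : inK E by apply: inK_addV; [exact: inK_empty|exact: finite_finset].
have iE : embedding (fun _ : E => false : overpoint).
  by split; [case=> [[]|[]] [[]|[]]|case=> [[]|]|case=> [[]|]|case=> [[]|]|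
    move=> n; case=> [[]|]|move=> n [[]|u] y' //; split=> // -[]].
have kE : embedding (fun _ : E => y).
  have nU : ~ inU M y.
    have [E' [h [E'K hE /(_ ord0)[z zy]]]] :=
      @rich_loc _ rM 1 (fun=> y) (fun=> rich_full rM y).
    move: yV; rewrite -zy (emb_V hE) => zV /(emb_U hE) zU; exact: (K_notUV E'K zU zV).
  have [E' [h [E'K hE /(_ ord0)[z zy]]]] :=
      @rich_loc _ rM 1 (fun=> y) (fun=> rich_full rM y).
  split.
  - by case=> [[]|[]] [[]|[]].
  - by case=> [[]|].
  - by case=> [[]|].
  - case=> [[]|u] /=; rewrite -zy (emb_fp hE); case e: (fp z) => //=.
    by case: nU; rewrite -zy (emb_U hE); exact: (K_fp_dom E'K e).
  - move=> n [[]|u] [[]|u'] /=; rewrite -zy (emb_ff hE); case e: (ff n z z) => //=.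
    by case: nU; rewrite -zy (emb_U hE); case: (K_ff_dom E'K e).
  - move=> n [[]|u] [[]|u'] /=; split=> //.
    by rewrite -zy (emb_rR hE) => /(K_rR_U E'K)[]; rewrite -(emb_U hE) zy.
have [k' k'E k'i] := rich_ext rM EK inK_overpoint iE kE.
exists (k' true); first exact/(emb_U k'E).
by rewrite (emb_fp k'E) /= -(k'i (inr tt)).
Qed.

End RichV.

(** * Transfer between rich structures *)

(** Universal first-order consequences of the axioms of K, which therefore hold in every model of
    the theory. That the [R_n] cover all pairs from U is an infinite disjunction and is not among
    them. *)
Record Kuniv (M : Lstructure) : Prop := KUniv {
  ax_UV : forall x : M, inU M x -> inV M x -> False;
  ax_fp : forall x y : M, fp x = Some y -> inU M x;
  ax_ff : forall n (x y z : M), ff n x y = Some z -> inU M x /\ inU M y;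
  ax_rR_U : forall n (x y : M), rR n x y -> inU M x /\ inU M y;
  ax_rR_eq : forall m n (x y : M), rR m x y -> rR n x y -> m = n;
  ax_rR_ff : forall n m (x y : M), n <= m -> rR n x y -> ff m x y = Some x }.

Lemma locK_univ (M : Lstructure) : full M -> locK M -> Kuniv M.
Proof.
move=> fM LM.
have L1 (x : M) : exists (E : Lstructure) (h : E -> M) (z : E),
    [/\ inK E, embedding h & h z = x].
  have [E [h [EK hE cov]]] := LM 1 (fun=> x) (fun=> fM x).
  by have [z zx] := cov ord0; exists E, h, z.
have L2 (x y : M) : exists (E : Lstructure) (h : E -> M) (z w : E),
    [/\ inK E, embedding h, h z = x & h w = y].
  have [E [h [EK hE cov]]] :=
    LM 2 (vcons x (vcons y (@vnil M))) (fun i => fM _).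
  have [z] := cov ord0; have [w] := cov (lift ord0 ord0).
  by rewrite vconsS !vcons0 => wy zx; exists E, h, z, w.
split.
- move=> x; have [E [h [z [EK hE <-]]]] := L1 x.
  by rewrite (emb_U hE) (emb_V hE); exact: K_notUV.
- move=> x y; have [E [h [z [EK hE <-]]]] := L1 x.
  rewrite (emb_U hE) (emb_fp hE); case e: (fp z) => [t|] // _.
  exact: (K_fp_dom EK e).
- move=> n x y t; have [E [h [z [w [EK hE <- <-]]]]] := L2 x y.
  rewrite !(emb_U hE) (emb_ff hE); case e: (ff n z w) => [u|] // _.
  exact: (K_ff_dom EK e).
- move=> n x y; have [E [h [z [w [EK hE <- <-]]]]] := L2 x y.
  by rewrite !(emb_U hE) (emb_rR hE); exact: (K_rR_U EK).
- move=> m n x y; have [E [h [z [w [EK hE <- <-]]]]] := L2 x y.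
  by rewrite !(emb_rR hE); exact: (K_rR_disjoint EK).
- move=> n m x y le; have [E [h [z [w [EK hE <- <-]]]]] := L2 x y.
  by rewrite (emb_rR hE) (emb_ff hE) => /(K_rR_ff EK le) ->.
Qed.

Lemma rich_univ (M : Lstructure) : rich M -> Kuniv M.
Proof. by move=> rM; apply: locK_univ; [exact: rich_full|exact: rich_loc]. Qed.

(** Points of V lie outside the domains of all functions and relations, so an embedding extends by
    any injective family of points of V outside its range. *)
Lemma embedding_addV_case (E M : Lstructure) (J : Type) (h : E -> M) (f : J -> M) :
  Kuniv M -> embedding h -> injective f -> (forall j, inV M (f j)) ->
  (forall x j, h x <> f j) ->
  embedding (fun x : addV E J => match x with inl x => h x | inr j => f j end).
Proof.
move=> ax hE fI fV hf.
have nU j : ~ inU M (f j) by move=> /(ax_UV ax); apply.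
split.
- move=> [x|j] [y|k]; first by move/(emb_inj hE) ->.
  + by move/hf.
  + by move/esym/hf.
  + by move/fI ->.
- move=> [x|j] /=; first by rewrite (emb_U hE).
  by split=> // /nU.
- move=> [x|j] /=; first by rewrite (emb_V hE).
  by split.
- move=> [x|j] /=; first by rewrite (emb_fp hE); case: (fp x).
  by case e: (fp _) => [y|] //; case: (nU j); exact: (ax_fp ax e).
- move=> n [x|j] [y|k] /=; first by rewrite (emb_ff hE); case: (ff n x y).
  + by case e: (ff _ _ _) => [z|] //; case: (nU k); case: (ax_ff ax e).
  + by case e: (ff _ _ _) => [z|] //; case: (nU j); case: (ax_ff ax e).
  + by case e: (ff _ _ _) => [z|] //; case: (nU j); case: (ax_ff ax e).
- move=> n [x|j] [y|k] /=; first by rewrite (emb_rR hE).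
  + by split=> // /(ax_rR_U ax)[_ /nU].
  + by split=> // /(ax_rR_U ax)[/nU].
  + by split=> // /(ax_rR_U ax)[/nU].
Qed.

Lemma card_le_fun (T U : Type) (A : set T) (B : set U) : B !=set0 -> A #<= B ->
  exists f : T -> U, (forall x, B (f x)) /\
    (forall x y, A x -> A y -> f x = f y -> x = y).
Proof.
move=> [b Bb]; elim/Pchoice: U => U in B b Bb *.
move=> /card_leP[f].
exists (fun x => if pselect (A x) is left Ax then val (f (SigSub (mem_set Ax))) else b).
split=> [x|x y Ax Ay].
  case: pselect => // Ax; exact: set_valP.
case: pselect => // Ax'; case: pselect => // Ay' /val_inj.
by move=> /(inj (mem_set I) (mem_set I))/(congr1 val).
Qed.

Lemma finite_le_infinite (T U : Type) (A : set T) (B : set U) :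
  finite_set A -> infinite_set B -> A #<= B.
Proof.
by move=> /finite_set_countable cA /infiniteP; exact: card_le_trans.
Qed.

Lemma finite_inj (T U : Type) (A : set T) (B : set U) :
  finite_set A -> infinite_set B ->
  exists f : T -> U, (forall x, B (f x)) /\
    (forall x y, A x -> A y -> f x = f y -> x = y).
Proof.
move=> fA iB; apply: card_le_fun; last exact: finite_le_infinite.
exact: infinite_setN0.
Qed.

(** * From rich structures to arbitrary models of the theory *)

Section Transfer.
Variables B C : Lstructure.
Hypotheses (rB : rich B) (hC : models0 C (Th0 B)).

(** A finite set of points of V is a member of K without relations. The set [J] of values of [v]
    embeds in [M] as it is and in [N] by [w \o g], where [g] picks an index for each value. *)
Lemma sat_Vtuple (M N : Lstructure) n (phi : formula void n) v w :
  rich M -> rich N -> (forall i, inV M (v i)) -> (forall i, inV N (w i)) ->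
  (forall i j, v i = v j <-> w i = w j) ->
  sat (of_void M) phi v <-> sat (of_void N) phi w.
Proof.
move=> rM rN vV wV vw.
pose J := set_type (range v).
have /choice[g gv] : forall j : J, exists i, v i = val j.
  by move=> j; have [i _ e] := set_valP j; exists i.
have hE := embedding_addV_case (J := J) (f := val) (rich_univ rM)
  (embedding_empty M).
have kE := embedding_addV_case (J := J) (f := w \o g) (rich_univ rN)
  (embedding_empty N).
apply: (sat_match rM rN (inK_addV inK_empty _) (hE _ _ _) (kE _ _ _)).
- by apply: finite_setT_type; exact/finite_image/finite_finset.
- exact: val_inj.
- by move=> j; rewrite -gv.
- by [].
- by move=> i j /vw; rewrite !gv => /val_inj.
- by move=> j /=.
- by [].
- by [].
- move=> i; exists (inr (SigSub (mem_set (imageT v i)))); split=> //=.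
  by apply/vw; rewrite gv.
Qed.

Definition Fpattern (T : Type) n (a : 'I_n -> T) : formula void n :=
  Fand (Fands (fun i => FV (Tvar _ i)))
    (Fands (fun i => Fands (fun j =>
      Fand (Fguard (a i = a j) (Feq (Tvar _ i) (Tvar _ j)))
           (Fguard (a i <> a j) (Fnot (Feq (Tvar _ i) (Tvar _ j))))))).

Lemma sat_Fpattern (T : Type) n (a : 'I_n -> T) (M : Lstructure) (v : 'I_n -> M) :
  sat (of_void M) (Fpattern a) v <->
  (forall i, inV M (v i)) /\ forall i j, a i = a j <-> v i = v j.
Proof.
rewrite sat_and !sat_ands; split=> -[H1 H2]; split.
- by move=> i; have [x [->]] := H1 i.
- move=> i j; have := H2 i; rewrite sat_ands => /(_ j).
  rewrite sat_and !sat_guard sat_not sat_eqvar => -[H3 H4].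
  by split=> // e; apply: contrapT => /H4.
- by move=> i; exists (v i).
- move=> i; rewrite sat_ands => j.
  by rewrite sat_and !sat_guard sat_not sat_eqvar H2.
Qed.

(** [C] need not be rich. In [B], all tuples from V with the equality pattern of [a] satisfy the
    same formulas; so if one satisfies [chi], the sentence that the pattern implies [chi] is in the
    theory and holds in [C]. Using this for [phi] and for its negation gives both directions. *)
Lemma transfer_tuple (M : Lstructure) n (phi : formula void n) a w :
  rich M -> (forall i, inV C (a i)) -> (forall i, inV M (w i)) ->
  (forall i j, a i = a j <-> w i = w j) ->
  sat (of_void C) phi a <-> sat (of_void M) phi w.
Proof.
move=> rM aV wV aw.
have [f [fV fI]] : exists f : C -> B, (forall x, inV B (f x)) /\
    (forall x y, range a x -> range a y -> f x = f y -> x = y).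
  apply: finite_inj (rich_infiniteV rB); apply: finite_image; exact: finite_finset.
have fa i j : a i = a j <-> f (a i) = f (a j).
  by split=> [->//|]; apply: fI; exact: imageT.
have sB (chi : formula void n) (bw : 'I_n -> B) : (forall i, inV B (bw i)) ->
    (forall i j, a i = a j <-> bw i = bw j) ->
    sat (of_void B) chi (f \o a) <-> sat (of_void B) chi bw.
  move=> bV bp; apply: (sat_Vtuple _ rB rB) => [i|//|i j]; first exact: fV.
  by rewrite -fa.
have key (chi : formula void n) :
    sat (of_void B) chi (f \o a) -> sat (of_void C) chi a.
  move=> Hchi; have : Th0 B (closeall (Fimp (Fpattern a) chi)).
    apply/sat_closeall => bw /sat_Fpattern[bV bp]; exact/(sB chi bw bV bp).
  move=> /hC/sat_closeall/(_ a); apply; exact/sat_Fpattern.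
have fw i j : (f \o a) i = (f \o a) j <-> w i = w j by rewrite /= -fa.
rewrite -(sat_Vtuple phi rB rM (fun i => fV (a i)) wV fw).
split=> [H|]; last exact: key.
by apply: contrapT => nB; exact: (key (Fnot phi) nB H).
Qed.

Lemma transfer (P : Type) (M : Lstructure) (phi : formula P 0) (c : P -> C) (d : P -> M) :
  rich M -> (forall a, inV C (c a)) -> (forall a, inV M (d a)) ->
  (forall a b, params phi a -> params phi b -> c a = c b <-> d a = d b) ->
  sat c phi (@vnil C) <-> sat d phi (@vnil M).
Proof.
move=> rM cV dV cd.
(* [S] contains the parameters and is nonempty unless [P] is empty, so that the index map [r] below
   has a default value. *)
have [S [Sfin pS Scd SP]] : exists S : set P,
    [/\ finite_set S, params phi `<=` S,
        forall a b, S a -> S b -> c a = c b <-> d a = d b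
      & S !=set0 \/ forall a : P, False].
  have [[x px]|np] := pselect (params phi !=set0).
    by exists (params phi); split=> //; [exact: finite_params|left; exists x].
  have pS (T : set P) : params phi `<=` T by move=> x px; case: np; exists x.
  have [[x]|nP] := pselect (inhabited P).
    exists [set x]; split=> //; last by left; exists x.
    by move=> a b -> ->.
  exists set0; split=> //.
  by right=> a; apply: nP.
have [m [a aS]] := finite_enum Sfin.
have /choice[r ra] : forall x, exists i, S x -> a i = x.
  move=> x; have [Sx|nSx] := pselect (S x).
    by move: (Sx); rewrite -aS => -[i _ e]; exists i.
  case: SP => [[y]|/(_ x)//]; rewrite -aS => -[i _ _].
  by exists i => Sx; case: nSx; rewrite -aS.
pose psi : formula void m := ren phi (@vnil _) (fun x => inl (r x)).
have psiE (N : Lstructure) (e : P -> N) :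
    sat (of_void N) psi (e \o a) <-> sat e phi (@vnil N).
  rewrite sat_ren (vnil_eq (_ \o vnil _) (@vnil N)).
  by apply: sat_eq_params => x /pS Sx /=; rewrite ra.
rewrite -!psiE; apply: transfer_tuple => //= i j.
by apply: Scd; rewrite -aS; exact: imageT.
Qed.

Lemma indiscernible_Vset (A : set C) : A `<=` inV C -> indiscernible A.
Proof.
move=> AV n a b aI bI phi.
have Vv (x : A) : inV C (val x) by apply/AV/set_valP.
have [f [fV fI]] := finite_inj (finite_finset (X := [set: 'I_n])) (rich_infiniteV rB).
have H (s : 'I_n -> A) : injective s ->
    sat (of_void C) phi (val \o s) <-> sat (of_void B) phi f.
  move=> sI; apply: transfer_tuple => // [i|i j]; first exact: Vv.
  by split=> [/val_inj/sI->|/fI->].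
by rewrite !H.
Qed.

End Transfer.

(** * Formulas describing a finite structure *)

Section ParamsConnectives.
Variable P : Type.

Lemma params_closeall n (phi : formula P n) : params (closeall phi) = params phi.
Proof. by elim: n phi => //= n IH phi; rewrite IH. Qed.

Lemma params_Fexs m n (phi : formula P (m + n)) : params (Fexs m n phi) = params phi.
Proof. by elim: m phi => //= m IH phi; rewrite IH /= !setU0. Qed.

Lemma params_Fand n (phi psi : formula P n) :
  params (Fand phi psi) = params phi `|` params psi.
Proof. by rewrite /= !setU0. Qed.

Lemma params_Fguard n (Q : Prop) (phi : formula P n) S :
  params phi `<=` S -> params (Fguard Q phi) `<=` S.
Proof. by rewrite /Fguard; case: asboolP => _ //= _; rewrite setU0. Qed.

Lemma params_Fands n (I : finType) (F : I -> formula P n) S :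
  (forall i, params (F i) `<=` S) -> params (Fands F) `<=` S.
Proof.
move=> FS; rewrite /Fands; elim: (enum I) => [|i s IH]; first by rewrite /= setU0.
by rewrite [foldr _ _ _]/= params_Fand subUset; split.
Qed.

End ParamsConnectives.

(** Finitely many pairs have at most one index each. By (vi), every [f_m] with m at least [N] is the
    first projection on U, so nothing about [E] remains to be said beyond [N]. *)
Lemma K_rR_bound (E : Lstructure) : inK E ->
  exists N, forall n (x y : E), rR n x y -> n < N.
Proof.
move=> EK; have [k [e eE]] := K_enum EK.
have /choice[g gR] : forall ij : 'I_k * 'I_k, exists n,
    forall m, rR m (e ij.1) (e ij.2) -> m = n.
  move=> [i j] /=; have [[n Rn]|nR] := pselect (exists n, rR n (e i) (e j)).
    by exists n => m Rm; exact: (K_rR_disjoint EK Rm Rn).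
  by exists 0 => m Rm; case: nR; exists m.
exists (\max_ij g ij).+1 => n x y.
have [i <-] := eE x; have [j <-] := eE y => /(gR (i, j)) ->.
by rewrite ltnS; exact: leq_bigmax.
Qed.

Section Diagram.
Variables (E : Lstructure) (k : nat) (e : 'I_k -> E) (N : nat).
Hypotheses (EK : inK E) (eE : forall x, exists i, e i = x).
Hypothesis RN : forall n (x y : E), rR n x y -> n < N.

Section Formulas.
Variable P : Type.

Definition Fdiagram1 n (y : 'I_k -> 'I_n) (i : 'I_k) : formula P n :=
  Fand (Fguard (inU E (e i)) (FU (Tvar P (y i))))
       (Fguard (inV E (e i)) (FV (Tvar P (y i)))).

Definition Fdiagram2 n (y : 'I_k -> 'I_n) (i j : 'I_k) : formula P n :=
  Fand (Fand (Fguard (e i = e j) (Feq (Tvar P (y i)) (Tvar P (y j))))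
             (Fguard (e i <> e j) (Fnot (Feq (Tvar P (y i)) (Tvar P (y j))))))
       (Fguard (fp (e i) = Some (e j)) (Feq (Tfp (Tvar P (y i))) (Tvar P (y j)))).

Definition Fdiagram3 n (y : 'I_k -> 'I_n) (i j : 'I_k) (m : 'I_N) : formula P n :=
  Fand (Fguard (rR m (e i) (e j)) (FR m (Tvar P (y i)) (Tvar P (y j))))
       (Fands (fun l => Fguard (ff m (e i) (e j) = Some (e l))
         (Feq (Tff m (Tvar P (y i)) (Tvar P (y j))) (Tvar P (y l))))).

(** Only indices below [N] are listed, which keeps the diagram finite; [y] tells which variable
    stands for which listed point of [E]. *)
Definition Fdiagram n (y : 'I_k -> 'I_n) : formula P n :=
  Fand (Fands (Fdiagram1 y))
       (Fands (fun i => Fands (fun j =>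
         Fand (Fdiagram2 y i j) (Fands (Fdiagram3 y i j))))).

Lemma params_Fdiagram n (y : 'I_k -> 'I_n) : params (Fdiagram y) `<=` set0.
Proof.
rewrite params_Fand subUset; split.
  apply: params_Fands => i; rewrite params_Fand subUset.
  by split; exact: params_Fguard.
apply: params_Fands => i; apply: params_Fands => j.
rewrite params_Fand subUset; split.
  rewrite !params_Fand !subUset; split; first split.
  - by apply: params_Fguard; rewrite /= setU0.
  - by apply: params_Fguard; rewrite /= !setU0.
  - by apply: params_Fguard; rewrite /= setU0.
apply: params_Fands => m; rewrite params_Fand subUset; split.
  by apply: params_Fguard; rewrite /= setU0.
by apply: params_Fands => l; apply: params_Fguard; rewrite /= !setU0.
Qed.

(** Apart from inequalities the diagram states only positive facts. The negative ones follow: each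
    pair of [E] from U has some index, which excludes all other indices in [M], while U and V are
    disjoint and bound the domains of the functions. *)
Lemma sat_Fdiagram (M : Lstructure) (c : P -> M) n (y : 'I_k -> 'I_n) v :
  Kuniv M ->
  sat c (Fdiagram y) v <->
  exists2 h : E -> M, embedding h & forall i, h (e i) = v (y i).
Proof.
move=> ax; rewrite sat_and !sat_ands; split; last first.
  move=> [h hE hv]; split=> i.
    rewrite sat_and !sat_guard; split=> H; exists (v (y i)) => //; rewrite -hv.
      exact/(emb_U hE).
    exact/(emb_V hE).
  rewrite sat_ands => j; rewrite !sat_and sat_ands !sat_guard sat_not !sat_eqvar.
  rewrite -!hv; split; first split; first split.
  - by move=> ->.
  - by move=> nij /(emb_inj hE).
  - by move=> eij; exists (v (y j)) => //=; rewrite -!hv (emb_fp hE) eij.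
  - move=> m; rewrite sat_and sat_guard sat_ands; split.
      move=> r; exists (v (y i)), (v (y j)); split=> //; rewrite -!hv.
      exact/(emb_rR hE).
    move=> l; rewrite sat_guard => eij; exists (v (y l)) => //=.
    by rewrite -!hv (emb_ff hE) eij.
move=> [H1 H2].
have vU i : inU E (e i) -> inU M (v (y i)).
  by have := H1 i; rewrite sat_and !sat_guard => -[H _] /H[x [->]].
have vV i : inV E (e i) -> inV M (v (y i)).
  by have := H1 i; rewrite sat_and !sat_guard => -[_ H] /H[x [->]].
have {}H2 i j : sat c (Fand (Fdiagram2 y i j) (Fands (Fdiagram3 y i j))) v.
  by have := H2 i; rewrite sat_ands; apply.
have veq i j : e i = e j -> v (y i) = v (y j).
  by have := H2 i j; rewrite !sat_and !sat_guard sat_eqvar => -[[[H _] _] _] /H.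
have vneq i j : v (y i) = v (y j) -> e i = e j.
  have := H2 i j; rewrite !sat_and !sat_guard sat_not sat_eqvar => -[[[_ H] _] _] vij.
  by apply: contrapT => /H.
have vfp i j : fp (e i) = Some (e j) -> fp (v (y i)) = Some (v (y j)).
  have := H2 i j; rewrite !sat_and !sat_guard => -[[_ H] _] /H[x /= ->].
  by move=> [->].
have vR i j m : rR m (e i) (e j) -> rR m (v (y i)) (v (y j)).
  move=> r; have := H2 i j; rewrite sat_and sat_ands => -[_ /(_ (Ordinal (RN r)))].
  rewrite sat_and sat_guard => -[/(_ r) [a [b /= [[->] [->]]]]] //.
have vff i j l m : m < N -> ff m (e i) (e j) = Some (e l) ->
    ff m (v (y i)) (v (y j)) = Some (v (y l)).
  move=> mN eij; have := H2 i j; rewrite sat_and sat_ands => -[_ /(_ (Ordinal mN))].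
  rewrite sat_and sat_ands => -[_ /(_ l)]; rewrite sat_guard => /(_ eij)[x /= ->].
  by move=> [->].
have /choice[g ge] := eE.
pose h x := v (y (g x)).
have hv i : h (e i) = v (y i) by apply: veq; rewrite ge.
have hU x : inU E x -> inU M (h x) by move=> xU; apply: vU; rewrite ge.
have hV x : inV E x -> inV M (h x) by move=> xV; apply: vV; rewrite ge.
have hUE x : inU M (h x) -> inU E x.
  by move=> U; have [//|/hV V] := K_full EK x; case: (ax_UV ax U V).
have hR m x x' : rR m x x' -> rR m (h x) (h x').
  by move=> r; apply: vR; rewrite !ge.
exists h => //; split.
- by move=> x x' /vneq; rewrite !ge.
- by move=> x; split=> [/hUE|/hU].
- move=> x; split=> [V|/hV//].
  by have [/hU U|//] := K_full EK x; case: (ax_UV ax U V).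
- move=> x; have [xU|xV] := K_full EK x.
    have [z ez _] := K_fp_total EK xU; rewrite ez /=.
    by apply: vfp; rewrite !ge.
  have -> : fp x = None.
    by case ex: (fp x) => [z|//]; case: (K_notUV EK (K_fp_dom EK ex) xV).
  by case ex: (fp (h x)) => [z|//]; case: (ax_UV ax (ax_fp ax ex) (hV _ xV)).
- move=> m x x'; have [[xU x'U]|nU] := pselect (inU E x /\ inU E x').
    have [r rxx'] := K_rR_cover EK xU x'U.
    have [mN|Nm] := ltnP m N.
      have [z ez _] := K_ff_total EK m xU x'U; rewrite ez /=.
      by apply: vff => //; rewrite !ge.
    (* For m at least [N] both sides are the first argument, by (vi) in [E] and in [M]. *)
    have rm : r <= m by apply: ltnW; apply: leq_trans Nm; exact: RN rxx'.
    by rewrite (K_rR_ff EK rm rxx') (ax_rR_ff ax rm (hR _ _ _ rxx')).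
  have -> : ff m x x' = None.
    by case ex: (ff m x x') => [z|//]; case: nU; exact: (K_ff_dom EK ex).
  case ex: (ff _ _ _) => [z|//]; case: nU.
  by have [/hUE ? /hUE ?] := ax_ff ax ex.
- move=> m x x'; split=> [R|/hR//].
  have [/hUE xU /hUE x'U] := ax_rR_U ax R.
  have [r rxx'] := K_rR_cover EK xU x'U.
  by rewrite (ax_rR_eq ax R (hR _ _ _ rxx')).
Qed.

End Formulas.

End Diagram.

(** All [k] points of the copy are quantified away; the free variables and the parameters [s j] are
    equated with the points that [x] and [t] prescribe. *)
Lemma copy_formula (E : Lstructure) (P : Type) n m (x : 'I_n -> E)
    (s : 'I_m -> P) (t : 'I_m -> E) : inK E ->
  exists2 psi : formula P n, params psi `<=` range s &
    forall (M : Lstructure) (c : P -> M) v, Kuniv M ->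
    (sat c psi v <-> exists h : E -> M,
      [/\ embedding h, forall i, h (x i) = v i & forall j, h (t j) = c (s j)]).
Proof.
move=> EK; have [k [e eE]] := K_enum EK; have [N RN] := K_rR_bound EK.
have /choice[g ge] := eE.
exists (Fexs k n (Fand (Fdiagram e N P (lshift n))
  (Fand (Fands (fun i => Feq (Tvar P (rshift k i)) (Tvar P (lshift n (g (x i))))))
        (Fands (fun j => Feq (Tpar _ (s j)) (Tvar P (lshift n (g (t j))))))))).
  rewrite params_Fexs params_Fand subUset; split.
    exact: subset_trans (@params_Fdiagram _ _ _ _ _ _ _) (@sub0set _ _).
  rewrite params_Fand subUset; split.
  - by apply: params_Fands => i; rewrite /= setU0.
  - by apply: params_Fands => j; rewrite /= setU0 => _ ->; exact: imageT.
move=> M c v ax; rewrite sat_Fexs; split=> [[u]|[h [hE hx ht]]].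
  rewrite sat_and (sat_Fdiagram EK eE RN)// sat_and !sat_ands => -[[h hE hu] [Hx Ht]].
  exists h; split=> // [i|j].
    by have := Hx i; rewrite sat_eqvar vcat_rshift => ->; rewrite -hu ge.
  by have [z /= [->]] := Ht j; rewrite -hu ge => -[].
exists (h \o e); rewrite sat_and (sat_Fdiagram EK eE RN)// sat_and !sat_ands; split.
  by exists h => // i; rewrite vcat_lshift.
split=> [i|j].
  by rewrite sat_eqvar vcat_rshift vcat_lshift /= ge hx.
by exists (c (s j)) => //=; rewrite vcat_lshift /= ge ht.
Qed.

(** * Isolated types over a set of points of V *)

Lemma card_eq_fun (T U : Type) (A : set T) (B : set U) : B !=set0 -> A #= B ->
  exists f : T -> U, [/\ forall x, B (f x),
    forall x y, A x -> A y -> f x = f y -> x = y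
    & forall y, B y -> exists2 x, A x & f x = y].
Proof.
move=> [b Bb] /card_bijP[f [g fK gK]].
exists (fun x => if pselect (A x) is left Ax then val (f (SigSub (mem_set Ax))) else b).
split=> [x|x y Ax Ay|y By].
- by case: pselect => // Ax; exact: set_valP.
- case: pselect => // Ax'; case: pselect => // Ay' /val_inj/(can_inj fK).
  by move=> /(congr1 val).
- pose z := g (SigSub (mem_set By)); have Az := set_valP z.
  exists (val z) => //; case: pselect => // Az'.
  by rewrite (_ : SigSub _ = z) ?gK//; exact: val_inj.
Qed.

(** The parameters of [theta] not named by [s] are added to [E] as new points of V. By the last
    hypothesis there are none, or every point of V in [E] carries a name; in the second case
    injectivity keeps the new points out of both copies. Hence the enlarged structure embeds along
    [h] and along [h'], and the two tuples match. *)
Lemma copies_agree (M E : Lstructure) (P : Type) n m (c : P -> M) (h h' : E -> M)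
    (x : 'I_n -> E) (s : 'I_m -> P) (t : 'I_m -> E) v v' (theta : formula P n) :
  rich M -> inK E -> embedding h -> embedding h' -> (forall a, inV M (c a)) ->
  (forall i, h (x i) = v i) -> (forall j, h (t j) = c (s j)) ->
  (forall i, h' (x i) = v' i) -> (forall j, h' (t j) = c (s j)) ->
  (forall a b, (params theta `|` range s) a -> (params theta `|` range s) b ->
    c a = c b -> a = b) ->
  (forall a : P, exists j, s j = a) \/ (forall z, inV E z -> exists j, t j = z) ->
  sat c theta v <-> sat c theta v'.
Proof.
move=> rM EK hE h'E cV hx ht h'x h't cI cov.
pose J := set_type (params theta `\` range s).
have Jin (j : J) := set_valP j.
have fresh (g : E -> M) : embedding g -> (forall j, g (t j) = c (s j)) ->
    forall z (j : J), g z <> c (val j).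
  move=> gE gt z j gz; have [jp js] := Jin j; apply: js.
  case: cov => [/(_ (val j))[i si]|covV]; first by exists i.
  have zV : inV E z by rewrite -(emb_V gE) gz.
  have [i tz] := covV _ zV; exists i => //; apply: cI.
  - by right; exact: imageT.
  - by left.
  - by rewrite -gt tz.
have fI : injective (c \o val : J -> M).
  move=> i j ij; apply: val_inj; apply: cI ij; left; exact: (Jin _).1.
have gE := embedding_addV_case (rich_univ rM) hE fI (fun j => cV _) (fresh _ hE ht).
have g'E := embedding_addV_case (rich_univ rM) h'E fI (fun j => cV _) (fresh _ h'E h't).
have Jfin : finite_set [set: J].
  by apply/finite_setT_type/finite_setD; exact: finite_params.
apply: (sat_match rM rM (inK_addV EK Jfin) gE g'E).
  move=> a pa; have [[j _ <-]|ns] := pselect (range s a).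
    by exists (inl (t j)); rewrite ht h't.
  have aJ : a \in params theta `\` range s by apply/mem_set.
  by exists (inr (SigSub aJ)).
by move=> i; exists (inl (x i)); rewrite hx h'x.
Qed.

(** * Density and atomicity over a subset of V *)

Section OverA.
Variables (B C : Lstructure) (A : set C).
Hypotheses (rB : rich B) (hC : models0 C (Th0 B)) (hA : A `<=` inV C).

Lemma ThA_transfer (M : Lstructure) (phi : formula A 0) (d : A -> M) :
  rich M -> (forall a, inV M (d a)) ->
  (forall a b, params phi a -> params phi b -> d a = d b -> a = b) ->
  ThA A phi <-> sat d phi (@vnil M).
Proof.
move=> rM dV dI; apply: (transfer rB hC) => // [a|a b pa pb].
  by apply/hA/set_valP.
by split=> [/val_inj ->|/dI->].
Qed.

Section Decides.
Variables (E : Lstructure) (n m : nat) (x : 'I_n -> E) (s : 'I_m -> A) (t : 'I_m -> E).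
Hypothesis EK : inK E.
Hypothesis cov :
  (forall a : A, exists j, s j = a) \/ (forall z, inV E z -> exists j, t j = z).
Variable psi : formula A n.
Hypothesis psiP : forall (M : Lstructure) (c : A -> M) v, Kuniv M ->
    (sat c psi v <-> exists h : E -> M,
      [/\ embedding h, forall i, h (x i) = v i & forall j, h (t j) = c (s j)]).

(** It suffices to look at [B] with a naming [d] that is injective on the finitely many parameters
    concerned. There all realisations of [psi] agree on [theta], so a single failure [v0] makes
    [psi] imply the negation. *)
Lemma copy_decides (theta : formula A n) :
  entails (ThA A) psi theta \/ entails (ThA A) psi (Fnot theta).
Proof.
have fin : finite_set (params psi `|` (params theta `|` range s)).
  by rewrite !finite_setU; split; [|split]; try exact: finite_params;
    exact/finite_image/finite_finset.
have [d [dV dI]] := finite_inj fin (rich_infiniteV rB).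
have ent (chi : formula A n) : params chi = params theta ->
    (forall v, sat d psi v -> sat d chi v) -> entails (ThA A) psi chi.
  move=> pchi H; have : ThA A (closeall (Fimp psi chi)).
    apply/(ThA_transfer rB dV); last by apply/sat_closeall.
    rewrite params_closeall /= pchi => a b pa pb.
    have sub : params psi `|` params theta `<=`
        params psi `|` (params theta `|` range s) by rewrite setUA; left.
    by apply: dI; exact: sub.
  by move=> T M c v /(_ _ T)/sat_closeall/(_ v).
have [H|/existsNP[v0 /not_implyP[v0psi v0theta]]] :=
    pselect (forall v, sat d psi v -> sat d theta v).
  by left; exact: ent.
right; apply: ent; first by rewrite /= setU0.
move=> v vpsi; apply/sat_not => vtheta; apply: v0theta.
move: v0psi vpsi => /(psiP _ _ (rich_univ rB))[h [hE hx ht]].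
move=> /(psiP _ _ (rich_univ rB))[h' [h'E h'x h't]].
apply/(copies_agree rB EK hE h'E dV hx ht h'x h't _ cov) => //.
by move=> a b pa pb; apply: dI; right.
Qed.

Lemma copy_isolates (M : Lstructure) (c : A -> M) v :
  models c (ThA A) -> sat c psi v -> isolates (ThA A) psi (tp c v).
Proof.
move=> cM vpsi; split=> // theta vtheta.
by have [//|/(_ _ _ _ cM vpsi)/sat_not] := copy_decides theta.
Qed.

End Decides.

(* If [A] is infinite and [M] countable, no naming of [A] is injective; [A0] is then
   a countable part of [A] which [d] maps bijectively onto [V]. *)
Lemma copy_witness (M E : Lstructure) n (A0 : set A) (d : A -> M) (h : E -> M)
    (v : 'I_n -> M) :
  inK E -> embedding h -> (forall a b, A0 a -> A0 b -> d a = d b -> a = b) ->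
  (forall i, exists z, h z = v i) ->
  (forall a, A0 a /\ exists z, h z = d a) \/
    (forall y, inV M y -> exists2 a, A0 a & d a = y) ->
  exists m (x : 'I_n -> E) (s : 'I_m -> A) (t : 'I_m -> E),
    [/\ forall i, h (x i) = v i, forall j, h (t j) = d (s j), range s `<=` A0
      & (forall a : A, exists j, s j = a) \/ (forall z, inV E z -> exists j, t j = z)].
Proof.
move=> EK hE dI /choice[x hx] cov.
pose S := A0 `&` d @^-1` (range h).
have Sfin : finite_set S.
  have : finite_set (d @` S).
    apply: (sub_finite_set (B := range h)); last exact/finite_image/K_finite.
    by move=> _ [a [_ ?] <-].
  have dS : {in S &, injective d}.
    by move=> a b /set_mem[a0 _] /set_mem[b0 _]; exact: dI.
  by rewrite (eq_finite_set (inj_card_eq dS)).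
have [m [s sS]] := finite_enum Sfin.
have inS j : S (s j) by rewrite -sS; exact: imageT.
have /choice[t ht] : forall j, exists z, h z = d (s j).
  by move=> j; have [_ [z _ e]] := inS j; exists z.
exists m, x, s, t; split=> //; first by rewrite sS => a [].
case: cov => [cov|cov]; [left=> a|right=> z zV].
  have : S a by have [a0 [z e]] := cov a; split=> //; exists z.
  by rewrite -sS => -[j _ <-]; exists j.
have [a a0 ea] := cov (h z) (iffRL (emb_V hE z) zV).
have : S a by split=> //; exists z.
by rewrite -sS => -[j _ sj]; exists j; apply: (emb_inj hE); rewrite ht sj.
Qed.

Lemma rich_atomic (M : Lstructure) (c : A -> M) :
  rich M -> (forall a, inV M (c a)) -> injective c ->
  finite_set [set: A] \/ (forall y, inV M y -> exists a, c a = y) ->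
  atomic_model (ThA A) c.
Proof.
move=> rM cV cI fin.
have cM : models c (ThA A).
  by move=> phi Tphi; apply/(ThA_transfer rM cV) => // a b _ _; exact: cI.
split=> // n v.
(* For finite [A] the tuple is enlarged by the names of all of [A], so that the copy contains them;
   otherwise the list added is empty. *)
have [m [a aP]] : exists m (a : 'I_m -> A),
    (forall b, exists i, a i = b) \/ (forall y, inV M y -> exists a, c a = y).
  case: fin => [/finite_enum[m [a aT]]|?]; last by exists 0, (@vnil A); right.
  exists m, a; left=> b; have : range a b by rewrite aT.
  by case=> i _ <-; exists i.
have [E [h [EK hE cover]]] := rich_loc rM (v := vcat v (c \o a)) (fun=> rich_full rM _).
have [|i||k [x [s [t [hx ht _ cov]]]]] :=
  @copy_witness M E n setT c h v EK hE.
- by move=> b b' _ _; exact: cI.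
- by have [z] := cover (lshift m i); rewrite vcat_lshift => <-; exists z.
- case: aP => [aP|aP]; [left=> b; split=> //|right=> y /aP[b <-]]; last by exists b.
  have [i <-] := aP b.
  by have [z] := cover (rshift n i); rewrite vcat_rshift => hz; exists z.
have [psi _ psiP] := copy_formula x s t EK.
exists psi; apply: (copy_isolates EK cov psiP) => //.
by apply/psiP; [exact: rich_univ|exists h].
Qed.

(** An infinite [A] has a countably infinite part containing [F], and this part is matched with V of
    the countable [B]. [F] will hold the parameters of the formula at hand, on which the naming has
    to be injective. *)
Lemma naming (F : set A) : countable [set: B] -> finite_set F ->
  exists (A0 : set A) (d : A -> B),
  [/\ F `<=` A0, forall a, inV B (d a),
    forall a b, A0 a -> A0 b -> d a = d b -> a = b
  & (A0 = setT /\ finite_set [set: A]) \/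
    (forall y, inV B y -> exists2 a, A0 a & d a = y)].
Proof.
move=> Bc Ffin; have [Afin|/infiniteP] := pselect (finite_set [set: A]).
  have [d [dV dI]] := finite_inj Afin (rich_infiniteV rB).
  by exists setT, d; split=> //; left.
move=> /card_subP[A1 A1nat _]; pose A0 := A1 `|` F.
have A0nat : A0 #= [set: nat].
  apply: eq_card_nat; last first.
    rewrite finite_setU => -[+ _]; rewrite (eq_finite_set A1nat); exact: infinite_nat.
  rewrite /A0 -bigcup2E; apply: bigcup_countable => // -[|[|i]] _ /=.
  - by rewrite (eq_countable A1nat).
  - exact: finite_set_countable.
  - by [].
have Vnat : inV B #= [set: nat].
  apply: eq_card_nat; last exact: rich_infiniteV.
  exact: sub_countable (subset_card_le (@subsetT _ _)) Bc.
have [||d [dV dI dS]] := @card_eq_fun A B A0 (inV B).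
- exact/infinite_setN0/rich_infiniteV.
- by rewrite (card_eq_trans A0nat)// card_eq_sym.
by exists A0, d; split=> //; [move=> a Fa; right|right].
Qed.

(** The given formula is realised in [B] under a suitable naming. The formula [psi] describing a
    copy of a member of K around the realisation decides every formula, and it is consistent with
    [phi], so it implies [phi]. *)
Lemma dense_over (Bc : countable [set: B]) : principal_types_dense (ThA A).
Proof.
move=> n phi [M0 [c0 [v0 [M0T v0phi]]]].
have [A0 [d [A0F dV dI A0cov]]] := naming Bc (finite_params phi).
have exC (chi : formula A n) : params chi `<=` A0 ->
    ~ ThA A (closeall (Fnot chi)) <-> exists v, sat d chi v.
  move=> chiA0; rewrite (ThA_transfer rB dV) ?sat_closeall.
    split=> [/existsNP[v /contrapT]|[v Hv] /(_ v)/sat_not//]; by exists v.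
  have -> : params (closeall (Fnot chi)) = params chi by rewrite params_closeall /= setU0.
  by move=> a b /chiA0 + /chiA0; exact: dI.
have [v vphi] : exists v, sat d phi v.
  by apply/exC => // /M0T/sat_closeall/(_ v0)/sat_not.
have [m [a aP]] : exists m (a : 'I_m -> A),
    (A0 = setT /\ forall b, exists i, a i = b) \/
    (forall y, inV B y -> exists2 a, A0 a & d a = y).
  case: A0cov => [[-> /finite_enum[m [a aT]]]|?]; last by exists 0, (@vnil A); right.
  exists m, a; left; split=> // b; have : range a b by rewrite aT.
  by case=> i _ <-; exists i.
have [E [h [EK hE cover]]] := rich_loc rB (v := vcat v (d \o a)) (fun=> rich_full rB _).
have [//|i||k [x [s [t [hx ht sA0 cov]]]]] := @copy_witness B E n A0 d h v EK hE.
- by have [z] := cover (lshift m i); rewrite vcat_lshift => <-; exists z.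
- case: aP => [[-> aP]|]; [left=> b; split=> //|by right].
  have [i <-] := aP b.
  by have [z] := cover (rshift n i); rewrite vcat_rshift => hz; exists z.
have [psi psis psiP] := copy_formula x s t EK.
have vpsi : sat d psi v by apply/psiP; [exact: rich_univ|exists h].
(* A joint realisation in [C] itself: it supplies the complete type and excludes that [psi] implies
   the negation of [phi]. *)
have [v' /sat_and[v'psi v'phi]] : exists v' : 'I_n -> C,
    sat (fun a : A => val a) (Fand psi phi) v'.
  have : ~ ThA A (closeall (Fnot (Fand psi phi))).
    apply/exC; last by exists v; apply/sat_and.
    by rewrite params_Fand subUset; split=> //; exact: subset_trans sA0.
  move=> /sat_closeall/existsNP[v' /contrapT Hv']; by exists v'.
have CT : models (fun a : A => val a) (ThA A) by [].
exists psi, (tp (fun a : A => val a) v'); split.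
- by exists C, (fun a : A => val a), v'.
- exact: (copy_isolates EK cov psiP).
- have [//|/(_ _ _ _ CT v'psi)/sat_not//] := copy_decides EK cov psiP phi.
Qed.

End OverA.

(** * Atomic models *)

Section AtomicModels.
Variables (B C : Lstructure) (A : set C).
Hypotheses (rB : rich B) (hC : models0 C (Th0 B)) (hA : A `<=` inV C).
Variables (M : Lstructure) (c : A -> M).
Hypothesis cM : models c (ThA A).

Lemma valid_transfer n (phi : formula A n) : params phi = set0 ->
  (forall (d : A -> B) w, sat d phi w) -> forall v, sat c phi v.
Proof.
move=> p0 Bphi; apply/sat_closeall/cM.
have [b bV] := infinite_setN0 (rich_infiniteV rB).
apply/(ThA_transfer rB hC hA (d := fun=> b)) => //; last by apply/sat_closeall.
by move=> x y; rewrite params_closeall p0.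
Qed.

Lemma ThA_univ : Kuniv M.
Proof.
have uB := rich_univ rB.
pose u (x y z : M) (i : 'I_3) := nth x [:: x; y; z] i.
pose X : term A 3 := Tvar A (@Ordinal 3 0 isT).
pose Y : term A 3 := Tvar A (@Ordinal 3 1 isT).
pose Z : term A 3 := Tvar A (@Ordinal 3 2 isT).
have satE := (sat_imp, sat_and, sat_U, sat_V, sat_R, sat_fp, sat_ff).
split.
- move=> x.
  have := @valid_transfer 3 (Fimp (FU X) (Fimp (FV X) (Fbot A 3))) _ _ (u x x x).
  rewrite !satE; apply; first by rewrite /= !setU0.
  by move=> d w; rewrite !satE; exact: (ax_UV uB).
- move=> x y.
  have := @valid_transfer 3 (Fimp (Feq (Tfp X) Y) (FU X)) _ _ (u x y y).
  rewrite !satE; apply; first by rewrite /= !setU0.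
  by move=> d w; rewrite !satE; exact: (ax_fp uB).
- move=> n x y z.
  have := @valid_transfer 3 (Fimp (Feq (Tff n X Y) Z) (Fand (FU X) (FU Y)))
    _ _ (u x y z).
  rewrite !satE; apply; first by rewrite /= !setU0.
  by move=> d w; rewrite !satE; exact: (ax_ff uB).
- move=> n x y.
  have := @valid_transfer 3 (Fimp (FR n X Y) (Fand (FU X) (FU Y))) _ _ (u x y y).
  rewrite !satE; apply; first by rewrite /= !setU0.
  by move=> d w; rewrite !satE; exact: (ax_rR_U uB).
- move=> m n x y; have [//|mn] := eqVneq m n.
  have := @valid_transfer 3 (Fimp (FR m X Y) (Fimp (FR n X Y) (Fbot A 3)))
    _ _ (u x y y).
  rewrite !satE => H Rm Rn; exfalso; apply: H Rm Rn; first by rewrite /= !setU0.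
  move=> d w; rewrite !satE => Rm Rn; move/eqP: mn; apply.
  exact: (ax_rR_eq uB Rm Rn).
- move=> n m x y nm.
  have := @valid_transfer 3 (Fimp (FR n X Y) (Feq (Tff m X Y) X)) _ _ (u x y y).
  rewrite !satE; apply; first by rewrite /= !setU0.
  by move=> d w; rewrite !satE; exact: (ax_rR_ff uB nm).
Qed.

Lemma ThA_inj : injective c.
Proof.
move=> a b cab; apply: contrapT => ab.
have : ThA A (Fnot (Feq (Tpar 0 a) (Tpar 0 b))).
  apply/sat_not => -[x /= [xa] [xb]]; apply: ab; apply: val_inj.
  exact: etrans xa (esym xb).
by move=> /cM T; apply: (T : ~ _); exists (c a); rewrite //= cab.
Qed.

Lemma ThA_fp_onto (a : A) : exists2 x, inU M x & fp x = Some (c a).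
Proof.
pose phi : formula A 1 := Fand (FU (Tvar A ord0)) (Feq (Tfp (Tvar A ord0)) (Tpar 1 a)).
have [b bV] := infinite_setN0 (rich_infiniteV rB).
have : ThA A (Fex phi).
  apply/(ThA_transfer rB hC hA (d := fun=> b)) => //.
    have -> : params (Fex phi) = [set a] by rewrite /= !setU0 !set0U.
    by move=> x y -> ->.
  have [x xU xb] := rich_fp_onto rB bV.
  apply/sat_ex; exists x; rewrite sat_and sat_U vcons0; split=> //.
  by exists b => //=; rewrite vcons0.
move=> /cM T; have /sat_ex[x] : sat c (Fex phi) (@vnil M) := T.
rewrite sat_and sat_U vcons0 => -[xU [y /= + [cy]]].
by rewrite vcons0 cy; exists x.
Qed.

Hypothesis at_c : atomic_model (ThA A) c.

(* A consistent formula is compatible with some member of [Theta], hence, if it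
   isolates a type, it implies that member. *)
Lemma atomic_sat_some n (Theta : set (formula A n)) (v : 'I_n -> M) :
  (forall theta, Theta theta -> params theta `<=` set0) ->
  (forall (d : A -> B) w, exists2 theta, Theta theta & sat d theta w) ->
  exists2 theta, Theta theta & sat c theta v.
Proof.
move=> T0 BT; have [phi [vphi phiP]] := at_c.2 n v.
have [d [dV dI]] := finite_inj (finite_params phi) (rich_infiniteV rB).
have exE (chi : formula A n) : params chi `<=` params phi ->
    ~ ThA A (closeall (Fnot chi)) <-> exists w, sat d chi w.
  move=> chip; rewrite (ThA_transfer rB hC hA rB dV) ?sat_closeall.
    split=> [/existsNP[w /contrapT]|[w Hw] /(_ w)/sat_not//]; by exists w.
  have -> : params (closeall (Fnot chi)) = params chi by rewrite params_closeall /= setU0.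
  by move=> a b /chip + /chip; exact: dI.
have [w wphi] : exists w, sat d phi w.
  by apply/exE => // /cM/sat_closeall/(_ v)/sat_not.
have [theta Ttheta wtheta] := BT d w.
have [v' /sat_and[v'phi v'theta]] : exists v' : 'I_n -> C,
    sat (fun a : A => val a) (Fand phi theta) v'.
  have : ~ ThA A (closeall (Fnot (Fand phi theta))).
    apply/exE; last by exists w; apply/sat_and.
    by rewrite params_Fand subUset; split=> // a /(T0 _ Ttheta).
  move=> /sat_closeall/existsNP[v' /contrapT Hv']; by exists v'.
have CT : models (fun a : A => val a) (ThA A) by [].
exists theta => //; apply: contrapT => vtheta.
by have /(_ _ _ _ CT v'phi)/sat_not := phiP (Fnot theta) vtheta.
Qed.

(** [Theta] consists of the parameter-free descriptions of tuples in copies of members of K. Every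
    tuple of the rich [B] satisfies one of them, hence so does every tuple of an atomic model: this
    infinite disjunction is what atomicity preserves. *)
Lemma atomic_locK n (v : 'I_n -> M) : exists (E : Lstructure) (h : E -> M),
  [/\ inK E, embedding h & forall i, exists z, h z = v i].
Proof.
pose Theta := [set theta : formula A n | params theta `<=` set0 /\
  exists (E : Lstructure) (x : 'I_n -> E), inK E /\
  forall (N : Lstructure) (d : A -> N) w, Kuniv N ->
    (sat d theta w <-> exists2 h : E -> N, embedding h & forall i, h (x i) = w i)].
have [||theta [_ [E [x [EK thetaP]]]]] := @atomic_sat_some n Theta v.
- by move=> theta [].
- move=> d w; have [E [h [EK hE /choice[x hx]]]] :=
    rich_loc rB (v := w) (fun=> rich_full rB _).
  (* With empty lists of names the description has no parameters. *)
  have [psi psi0 psiP] := copy_formula x (@vnil A) (@vnil E) EK.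
  have psiP' (N : Lstructure) (e : A -> N) u : Kuniv N ->
      sat e psi u <-> exists2 g : E -> N, embedding g & forall i, g (x i) = u i.
    move=> Nu; rewrite psiP//; split=> [[g [gE gx _]]|[g gE gx]]; exists g => //.
    by split=> // -[].
  exists psi; last by apply/psiP'; [exact: rich_univ|exists h].
  split; last by exists E, x.
  by move=> a /psi0[[]].
- move=> /(thetaP _ _ _ ThA_univ)[h hE hx]; exists E, h; split=> // i.
  by exists (x i).
Qed.

Lemma atomic_cl_finite (x y : M) : finite_set (cl [set x; y]).
Proof.
have [E [h [EK hE cov]]] := atomic_locK (vcons x (vcons y (@vnil M))).
have [a] := cov ord0; have [b] := cov (lift ord0 ord0).
rewrite vconsS !vcons0 => <- <-.
apply: (sub_finite_set (B := range h)); last exact/finite_image/K_finite.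
by move=> z /(cl_image2 hE)[w <- _]; exists w.
Qed.

Lemma K_triple_or (E : Lstructure) (a b d : E) : inK E ->
  inU E a -> inU E b -> inU E d ->
  [\/ cl [set b; d] a, cl [set a; d] b | cl [set a; b] d].
Proof.
move=> EK aU bU dU; pose x (i : 'I_3) := nth a [:: a; b; d] i.
have [|s] := K_triple EK (x := x); first by case=> -[|[|[]]].
have : s (inord 1) != s (inord 0) by rewrite (inj_eq perm_inj) -val_eqE /= !inordK.
have : s (inord 2) != s (inord 0) by rewrite (inj_eq perm_inj) -val_eqE /= !inordK.
set i := s (inord 0); set j := s (inord 1); set k := s (inord 2) => ki ji Hcl.
(* The two other indices are absorbed into all [l != i], so that only the value of [i] has to be
   split into cases. *)
have {Hcl} : cl [set z | exists2 l, l != i & z = x l] (x i).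
  by apply: cl_sub Hcl => z [->|->]; [exists j|exists k].
case: i {ki ji} => -[|[|[|//]]] ilt H; [apply: Or31|apply: Or32|apply: Or33];
  by apply: cl_sub H => z [[[|[|[]]] lt] // _ ->]; by [left|right].
Qed.

Lemma atomic_triple (x y z : M) : inU M x -> inU M y -> inU M z ->
  [\/ cl [set y; z] x, cl [set x; z] y | cl [set x; y] z].
Proof.
move=> xU yU zU.
have [E [h [EK hE cov]]] := atomic_locK (vcons x (vcons y (vcons z (@vnil M)))).
have [a] := cov ord0; have [b] := cov (lift ord0 ord0).
have [d] := cov (lift ord0 (lift ord0 ord0)).
rewrite !vconsS !vcons0 => dz by_ ax; move: xU yU zU; rewrite -dz -by_ -ax !(emb_U hE).
move=> aU bU dU; case: (K_triple_or EK aU bU dU) => /(cl_embedding2 hE) H.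
- by apply: Or31.
- by apply: Or32.
- by apply: Or33.
Qed.

End AtomicModels.

(** * Free sets and the cardinal aleph_1 *)

Section WellOrder.
Variables (W : Type) (R : rel W).
Hypothesis wo : well_order R.

Lemma wo_min (S : set W) : S !=set0 -> exists2 z, S z & forall x, S x -> R z x.
Proof.
move=> [x Sx]; have [|z [[/asboolP Sz zmin] _]] := wo (A := [pred x | `[<S x>]]).
  by exists x; apply/asboolP.
by exists z => // y Sy; apply: zmin; apply/asboolP.
Qed.

Lemma wo_refl x : R x x.
Proof. by have [|z ->] := @wo_min [set x]; [exists x | apply]. Qed.

Lemma wo_total x y : R x y \/ R y x.
Proof.
have [|z [->|->] H] := @wo_min [set x; y]; first by exists x; left.
- by left; apply: H; right.
- by right; apply: H; left.
Qed.

Lemma wo_anti x y : R x y -> R y x -> x = y.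
Proof.
move=> xy yx; have [|z [_ zU]] := wo (A := [pred t | `[<t = x \/ t = y>]]).
  by exists x; apply/asboolP; left.
have zx : z = x.
  apply: zU; split; first by apply/asboolP; left.
  by move=> t /asboolP[->|->] //; exact: wo_refl.
have zy : z = y; last by rewrite -zx.
apply: zU; split; first by apply/asboolP; right.
by move=> t /asboolP[->|->] //; exact: wo_refl.
Qed.

Lemma wo_trans x y z : R x y -> R y z -> R x z.
Proof.
move=> xy yz; have [|t Ht H] := @wo_min [set x; y; z]; first by exists x; left; left.
have xyz : R t x /\ R t y /\ R t z.
  by split; [|split]; apply: H; [left; left|left; right|right].
case: Ht xyz => [[->|->]|->] [tx [ty tz]] //.
- by rewrite (wo_anti xy tx).
- by have yx := tx; rewrite -(wo_anti yz ty) in tx *.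
Qed.

(** By totality, [~~ R y x] is the strict order of x below y; transfinite recursion will run along
    it. *)
Lemma wo_wf : well_founded (fun x y => ~~ R y x).
Proof.
move=> x; apply: contrapT => nAx.
have [|z nAz zmin] := @wo_min [set z | ~ Acc (fun x y => ~~ R y x) z]; first by exists x.
apply: nAz; constructor => y zy; apply: contrapT => /zmin.
by rewrite (negbTE zy).
Qed.

End WellOrder.

(** After well-ordering [T], either all initial segments are countable and [T] itself serves, or the
    points strictly below the least [w] with an uncountable segment do. *)
Lemma exists_omega1 (T : Type) : ~ countable [set: T] ->
  exists (W : Type) (R : rel W) (f : W -> T), is_omega1 R /\ injective f.
Proof.
elim/Peq: T => T Tunc; have [R wo] := well_ordering_principle T.
have [all|/existsNP[w1 w1P]] := pselect (forall w, countable [set v | R v w]).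
  by exists T, R, id; split.
have [|w wunc wmin] := wo_min wo (S := [set w | ~ countable [set v | R v w]]).
  by exists w1.
pose D := [set v | R v w && ~~ R w v].
pose W := set_type D; pose Q : rel W := fun x y => R (val x) (val y).
exists W, Q, val; split; last exact: val_inj.
split.
- move=> A [x Ax].
  have [|z [y [Ay yz]] zmin] :=
    wo_min wo (S := [set t | exists y : W, y \in A /\ val y = t]).
    by exists (val x), x.
  exists y; split=> [|y' [Ay' y'min]].
    by split=> // t At; rewrite /Q yz; apply: zmin; exists t.
  apply: val_inj; apply: (wo_anti wo); first by rewrite yz; apply: zmin; exists y'.
  exact: y'min.
- move=> Wc; apply: wunc.
  have Dc : countable D by rewrite -(eq_countable (card_setT D)).
  apply: (sub_countable (B := D `|` [set w])).
    apply: subset_card_le => v /= vw.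
    have [wv|wv] := boolP (R w v); first by right; exact: (wo_anti wo).
    by left; rewrite /D /= vw.
  rewrite -bigcup2E; apply: bigcup_countable => // -[|[|i]] _ //=.
- move=> v; have /andP[vw wv] := set_valP v.
  have vc : countable [set u | R u (val v)].
    by apply: contrapT => /wmin; rewrite (negbTE wv).
  apply: sub_countable vc; have H : {in [set u | Q u v] &, injective (val : W -> T)}.
    by move=> a b _ _; exact: val_inj.
  rewrite -(card_le_eql (inj_card_eq H)); apply: subset_card_le => _ [u /= uv <-].
  exact: uv.
Qed.

Lemma uncountable_nat_bool : ~ countable [set: nat -> bool].
Proof.
move=> /pcard_injP[f fI].
pose d n := `[< exists2 g, f g = n & ~~ g n >].
have := erefl (d (f d)); rewrite {1}/d; case: asboolP => [[g gd gn]|H] dd.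
  have gd' : g = d by apply: fI; rewrite ?in_setT.
  by move: gn; rewrite gd' -dd.
by apply: H; exists d => //; rewrite -dd.
Qed.

(** A copy of nat for each point of [W], with order type omega times omega_1, which is again
    omega_1. It bounds unions of [W] many countable sets. *)
Definition lexnat (W : Type) (R : rel W) : rel (W * nat) :=
  fun x y => `[< x.1 = y.1 /\ x.2 <= y.2 >] || `[< x.1 <> y.1 /\ R x.1 y.1 >].

Lemma omega1_lexnat (W : Type) (R : rel W) : is_omega1 R -> is_omega1 (lexnat R).
Proof.
move=> [wo Wunc Wc]; split.
- move=> A [[x n] Ax].
  have [|w [m Awm] wmin] := wo_min wo (S := [set w | exists n, (w, n) \in A]).
    by exists x, n.
  have ex : exists k, (w, k) \in A by exists m.
  exists (w, ex_minn ex); case: ex_minnP => k Awk kmin; split=> [|[v l] [Avl vlmin]].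
    split=> // -[v l] Avl; rewrite /lexnat /=.
    have [vw|nvw] := pselect (w = v).
      by rewrite asboolT //; split=> //; apply: kmin; rewrite vw.
    by apply/orP; right; apply/asboolP; split=> //; apply: wmin; exists l.
  have /orP[/asboolP[/= vw lk]|/asboolP[/= nvw vw]] := vlmin _ Awk.
    by rewrite vw in Avl *; congr pair; apply/eqP; rewrite eqn_leq lk kmin.
  by case: nvw; apply: (wo_anti wo) => //; apply: wmin; exists l.
- move=> Uc; apply: Wunc; apply: sub_countable Uc.
  have H : {in [set: W] &, injective (fun w : W => (w, 0))} by move=> a b _ _ [].
  by rewrite -(card_le_eql (inj_card_eq H)); exact: card_leT.
- move=> [w n]; apply: (sub_countable (B := [set v | R v w] `*` [set: nat])).
    apply: subset_card_le => -[v m] /= /orP[/asboolP[/= -> _]|/asboolP[_ //]].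
    by split=> //=; exact: wo_refl.
  by apply: countableX => //; exact: countableP.
Qed.

(** Transfinite recursion: only countably many values are taken before [w], so the uncountable [A]
    has a point left for [f w]. *)
Lemma omega1_le (W T : Type) (R : rel W) (A : set T) :
  is_omega1 R -> ~ countable A ->
  exists f : W -> T, (forall w, A (f w)) /\ injective f.
Proof.
move=> [wo Wunc Wc] Aunc.
have [t0 At0] : A !=set0.
  by apply/set0P; apply: contra_notN Aunc => /eqP ->.
(* [t0] is a default; [fP] shows that the recursion never falls back on it. *)
pose F w (rec : forall v, ~~ R w v -> T) : T :=
  if pselect (exists2 t, A t & forall v h, rec v h <> t) is left e
  then projT1 (cid2 e) else t0.
pose f := Fix (wo_wf wo) (fun=> T) F.
have fE w : f w = F w (fun v _ => f v).
  rewrite /f Fix_eq // => v g h gh; congr (F v).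
  by apply: functional_extensionality_dep => u; apply/funext => ?; exact: gh.
have fP w : A (f w) /\ forall v, ~~ R w v -> f v <> f w.
  have ex : exists2 t, A t & forall v (h : ~~ R w v), f v <> t.
    apply: contrapT => nex; apply: Aunc.
    apply: (sub_countable (B := f @` [set v | R v w])).
      apply: subset_card_le => t At; apply: contrapT => nt; apply: nex.
      exists t => // v wv fv; apply: nt; exists v => //=.
      by case: (wo_total wo v w) => //; rewrite (negbTE wv).
    exact: sub_countable (card_image_le _ _) (Wc w).
  rewrite [f w]fE /F; case: pselect => // e; case: (cid2 e) => t /= At Ht.
  by split.
exists f; split=> [w|v w vw]; first exact: (fP w).1.
apply: contrapT => nvw.
have [wv|wv] := boolP (R w v); last by case: ((fP w).2 v wv).
have [vw'|vw'] := boolP (R v w); last by case: ((fP v).2 w vw').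
by apply: nvw; exact: (wo_anti wo).
Qed.

Lemma countable_le_omega1 (W T : Type) (R : rel W) (A : set T) :
  is_omega1 R -> countable A -> A #<= [set: W].
Proof.
move=> [_ Wunc _] Ac; apply: card_le_trans Ac _; apply/infiniteP => Wf.
by apply: Wunc; exact: finite_set_countable.
Qed.

(** * Sets where one of any three points is in the finite closure of the other two *)

Section FreeSets.
Variables (T : Type) (X : set T) (F : T -> T -> set T).
Hypothesis Ffin : forall x y, X x -> X y -> finite_set (F x y).
Hypothesis Ftriple : forall x y z, X x -> X y -> X z ->
  [\/ F y z x, F x z y | F x y z].

Lemma free_closed (Y : set T) : Y `<=` X -> ~ countable Y ->
  (forall x y, Y x -> Y y -> F x y `&` X `<=` Y) -> X `<=` Y.
Proof.
move=> YX Yunc Ycl z Xz; apply: contrapT => nYz.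
have /infiniteP/card_subP[Y0 Y0nat Y0Y] : infinite_set Y.
  by move=> /finite_set_countable.
pose Z := \bigcup_(x in Y0) F x z.
have Zc : countable Z.
  apply: bigcup_countable => [|x Y0x]; first by rewrite (eq_countable Y0nat).
  by apply/finite_set_countable/Ffin => //; exact/YX/Y0Y.
have [y Yy nZy] : exists2 y, Y y & ~ Z y.
  apply: contrapT => nex; apply: Yunc; apply: sub_countable Zc.
  apply: subset_card_le => y Yy; apply: contrapT => nZ; apply: nex.
  by exists y.
have Xy := YX _ Yy.
have [x Y0x nFx] : exists2 x, Y0 x & ~ F y z x.
  apply: contrapT => nex.
  have : finite_set Y0.
    apply: sub_finite_set (Ffin Xy Xz) => x Y0x; apply: contrapT => nF.
    by apply: nex; exists x.
  by rewrite (eq_finite_set Y0nat); exact: infinite_nat.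
have Yx := Y0Y _ Y0x; have Xx := YX _ Yx.
(* The alternatives are excluded, in this order, by the choice of [x], by the choice of [y] outside
   [Z], and by the closedness of [Y]. *)
case: (Ftriple Xx Xy Xz) => [//|Fy|Fz].
  by apply: nZy; exists x.
by apply: nYz; exact: (Ycl x y).
Qed.

(** Iterates [F], which stands for the closure of a pair; intersecting with [X] keeps every stage
    inside the set on which [F] is known to be finite. *)
Fixpoint stage (S : set T) n : set T :=
  if n is n'.+1 then stage S n' `|`
    \bigcup_(xy in stage S n' `*` stage S n') (F xy.1 xy.2 `&` X)
  else S.

Lemma stage_sub S S' n m : S `<=` S' -> n <= m -> stage S n `<=` stage S' m.
Proof.
move=> SS'; elim: n m => [|n IH] [|m] //.
  by elim: m => [|m IH] _ x Sx; left; [exact: SS'|exact: IH].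
move=> nm x [Sx|[[y z] [/= Sy Sz] Fx]]; first by left; exact: (IH m).
by right; exists (y, z) => //; split; exact: (IH m).
Qed.

Lemma stage_X S n : S `<=` X -> stage S n `<=` X.
Proof. by move=> SX; elim: n => //= n IH x [/IH//|[yz _ [_]]]. Qed.

Lemma stage_countable S n : S `<=` X -> countable S -> countable (stage S n).
Proof.
move=> SX Sc; elim: n => //= n IH.
rewrite -bigcup2E; apply: bigcup_countable => // -[|[|i]] _ //=.
apply: bigcup_countable => [|[y z] [/= Sy Sz]]; first exact: countableX.
apply: sub_countable (subset_card_le (@subIsetl _ _ _)) _.
by apply/finite_set_countable/Ffin; [exact: (stage_X SX Sy)|exact: (stage_X SX Sz)].
Qed.

(** The closure of an injective image of omega_1 is closed and uncountable, hence all of [X]. It is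
    the union, over [w], of the countable closures of the images of initial segments, so [X] injects
    into [W * nat]. *)
Lemma free_le_aleph1 : card_le_aleph1 X.
Proof.
have [Xc|Xunc] := pselect (countable X).
  (* Some copy of omega_1 has to exist even for countable [X]; it is cut out of an uncountable
     type. *)
  have [W [R [_ [WR _]]]] := exists_omega1 uncountable_nat_bool.
  by exists W, R; split=> //; exact: countable_le_omega1 WR Xc.
have [W [R [g [WR gI]]]] : exists (W : Type) (R : rel W) (g : W -> X),
    is_omega1 R /\ injective g.
  by apply: exists_omega1; rewrite (eq_countable (card_setT X)).
have [wo Wunc Wc] := WR.
pose f w := val (g w).
have fX S : f @` S `<=` X by move=> _ [w _ <-]; exact: set_valP.
pose Y := \bigcup_n stage (range f) n.
have XY : X `<=` Y.
  apply: free_closed.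
  - by move=> x [n _]; apply: stage_X; exact: fX.
  - move=> Yc; apply: Wunc; apply: sub_countable Yc.
    have H : {in [set: W] &, injective f} by move=> a b _ _ /val_inj/gI.
    rewrite -(card_le_eql (inj_card_eq H)); apply: subset_card_le => x fx.
    by exists 0.
  - move=> x y [n _ Sx] [m _ Sy] z Fz; exists (maxn n m).+1 => //.
    right; exists (x, y) => //; split.
      by apply: stage_sub Sx => //; exact: leq_maxl.
    by apply: stage_sub Sy => //; exact: leq_maxr.
pose D w := f @` [set v | R v w].
have Dm v w : R v w -> D v `<=` D w.
  by move=> vw _ [u /= uv <-]; exists u => //=; exact: (wo_trans wo uv vw).
(* A point of the closure depends on finitely many starting points, which lie in one initial
   segment. *)
have cover n x : stage (range f) n x -> exists w m, stage (D w) m x.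
  elim: n x => [|n IH] x.
    by move=> [w _ <-]; exists w, 0, w => //=; exact: (wo_refl wo).
  move=> [/IH//|[[y z] [/= /IH[v [k Sy]] /IH[w [l Sz]]] Fx]].
  have [u vu wu] : exists2 u, R v u & R w u.
    by have [vw|wv] := wo_total wo v w; [exists w|exists v] => //; exact: (wo_refl wo).
  exists u, (maxn k l).+1; right; exists (y, z) => //; split.
    by apply: stage_sub Sy; [exact: Dm|exact: leq_maxl].
  by apply: stage_sub Sz; [exact: Dm|exact: leq_maxr].
have Ec w : countable (\bigcup_m stage (D w) m).
  apply: bigcup_countable => [|m _]; first exact: countableP.
  apply: stage_countable; first exact: fX.
  exact: sub_countable (card_image_le _ _) (Wc w).
have /choice[e eI] : forall w, exists e : T -> nat,
    {in \bigcup_m stage (D w) m &, injective e}.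
  by move=> w; apply/countable_injP.
have [w0 _] : [set: W] !=set0.
  by apply/set0P; apply: contra_notN Wunc => /eqP ->.
have /choice[r rP] : forall x, exists w, X x -> (\bigcup_m stage (D w) m) x.
  move=> x; have [/XY[n _ /cover[w [m Sx]]]|nX] := pselect (X x).
    by exists w => _; exists m.
  by exists w0.
exists (W * nat)%type, (lexnat R); split; first exact: omega1_lexnat.
(* A point is coded by a [w] whose closure contains it and by its number in that countable
   closure. *)
pose h x := (r x, e (r x) x).
have hI : {in X &, injective h}.
  move=> x y /set_mem Xx /set_mem Xy [rxy]; rewrite -rxy; apply: eI; apply/mem_set.
    exact: rP.
  by rewrite rxy; exact: rP.
by rewrite -(card_le_eql (inj_card_eq hI)); exact: card_leT.
Qed.

End FreeSets.

(** * Rich structures of cardinality aleph_1 *)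

Section ForthMap.
Variables (M B : Lstructure).
Hypotheses (ML : locK M) (BX : extK B).

Record pmap := PMap {
  pdom : Lstructure; pl : pdom -> M; pr : pdom -> B;
  pdomK : inK pdom; plE : embedding pl; prE : embedding pr }.

Definition pgraph (p : pmap) x y := exists z, @pl p z = x /\ @pr p z = y.

Lemma pgraph_fun p x y y' : pgraph p x y -> pgraph p x y' -> y = y'.
Proof. by move=> [z [<- <-]] [z' [/(emb_inj (@plE p)) -> <-]]. Qed.

Lemma pmap_forth p x : supp x ->
  exists2 p', forall t y, pgraph p t y -> pgraph p' t y & exists y, pgraph p' x y.
Proof.
move=> /(forth ML BX (pdomK p) (@plE p) (@prE p)).
move=> [F [h [k [i [FK [hE kE] [z zx] hi ki]]]]].
exists (PMap FK hE kE); last by exists (k z), z.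
by move=> t y [u [<- <-]]; exists (i u); rewrite /= hi ki.
Qed.

(** One direction of back-and-forth: the countably many points of the support are added in turn to a
    finite partial map. Points outside the support get the default [b0], so only the restriction to
    copies of members of K is an embedding. *)
Lemma forth_map (b0 : B) : countable (@supp M) ->
  exists e : M -> B, forall (E : Lstructure) (h : E -> M),
    inK E -> embedding h -> embedding (e \o h).
Proof.
move=> /countable_injP[f fI].
pose p0 := PMap inK_empty (embedding_empty M) (embedding_empty B).
have /choice[nxt nxtP] : forall np : nat * pmap, exists p',
    (forall t y, pgraph np.2 t y -> pgraph p' t y) /\
    forall x, supp x -> f x = np.1 -> exists y, pgraph p' x y.
  move=> [n p] /=; have [[x xs fx]|nx] := pselect (exists2 x, supp x & f x = n).
    have [p' pp' [y p'y]] := pmap_forth p xs; exists p'; split=> // t ts ft.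
    exists y; rewrite (_ : t = x) //; apply: fI; by [apply/mem_set|rewrite ft fx].
  by exists p; split=> // x xs fx; case: nx; exists x.
(* Stage [n.+1] takes care of the point with code [n], if there is one. *)
pose fix st n : pmap := if n is n'.+1 then nxt (n', st n') else p0.
have stm n m : n <= m -> forall t y, pgraph (st n) t y -> pgraph (st m) t y.
  move=> /subnK <-; elim: (m - n) => //= k IH t y /IH; exact: (nxtP (_, _)).1.
have cov x : supp x -> exists n y, pgraph (st n) x y.
  by move=> xs; exists (f x).+1; apply: (nxtP (f x, st (f x))).2.
have /choice[e eP] : forall x, exists y, supp x -> exists n, pgraph (st n) x y.
  move=> x; have [/cov[n [y p]]|nx] := pselect (supp x); last by exists b0.
  by exists y => _; exists n.
have eE n x y : supp x -> pgraph (st n) x y -> e x = y.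
  move=> /eP[m pm] pn; apply: (pgraph_fun (p := st (maxn n m))).
    by apply: stm pm; exact: leq_maxr.
  by apply: stm pn; exact: leq_maxl.
exists e => E h EK hE; have [k [a aE]] := K_enum EK.
have hs z : supp (h z) by apply/(embedding_supp hE)/K_full.
have /choice[l lP] : forall i, exists n, exists y, pgraph (st n) (h (a i)) y.
  by move=> i; exact: cov.
pose N := \max_(i < k) l i.
have hN z : exists u, @pl (st N) u = h z.
  have [i <-] := aE z; have [y ly] := lP i.
  by have [u [<- _]] := stm _ _ (leq_bigmax i) _ _ ly; exists u.
have [j jE hj] := embedding_factor hE (@plE (st N)) hN.
rewrite (_ : e \o h = @pr (st N) \o j); first exact: embedding_comp (@prE _) jE.
apply/funext => z /=; apply: (eE N) => //.
by exists (j z).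
Qed.

End ForthMap.

Lemma embedding_addV_map (E M : Lstructure) (I J : Type) (h : E -> M) (f : I -> J) :
  embedding h -> injective f ->
  embedding (fun x : addV E I => match x with inl x => inl (h x) | inr i => inr (f i) end
    : addV M J).
Proof.
move=> hE fI; split.
- by move=> [x|i] [y|j] //= []; [move/(emb_inj hE) ->|move/fI ->].
- by move=> [x|i] //=; exact: (emb_U hE).
- by move=> [x|i] //=; exact: (emb_V hE).
- by move=> [x|i] //=; rewrite (emb_fp hE); case: (fp x).
- by move=> n [x|i] [y|j] //=; rewrite (emb_ff hE); case: (ff n x y).
- by move=> n [x|i] [y|j] //=; exact: (emb_rR hE).
Qed.

Lemma locK_addV (M : Lstructure) (J : Type) : locK M -> locK (addV M J).
Proof.
move=> ML n v vs.
(* Entries among the added points are replaced by some entry [x0] from [M] before [ML] is applied;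
   if no entry comes from [M], the empty structure serves. *)
have [E [h [EK hE cov]]] : exists (E : Lstructure) (h : E -> M),
    [/\ inK E, embedding h & forall i x, v i = inl x -> exists z, h z = x].
  have [[i0 [x0 v0]]|nv] := pselect (exists i x, v i = inl x); last first.
    exists emptyL, (fun x => of_void M x); split.
    - exact: inK_empty.
    - exact: embedding_empty.
    - by move=> i x vi; case: nv; exists i, x.
  have [i|E [h [EK hE cov]]] := ML n (fun i => if v i is inl x then x else x0).
    case vi: (v i) => [x|j]; first by have := vs i; rewrite vi.
    by have := vs i0; rewrite v0.
  exists E, h; split=> // i x vi; have [z hz] := cov i; exists z.
  by rewrite hz vi.
pose I := set_type [set j | exists i, v i = inr j].
have Ifin : finite_set [set: I].
  apply: finite_setT_type.
  have : finite_set (inr @` [set j | exists i, v i = inr j] : set (M + J)).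
    apply: (sub_finite_set (B := range v)); last exact/finite_image/finite_finset.
    by move=> _ [j [i vi] <-]; exists i.
  by rewrite (eq_finite_set (inj_card_eq _)) // => a b _ _ [].
exists (addV E I); eexists; split.
- exact: inK_addV EK Ifin.
- exact: (embedding_addV_map (f := val : I -> J) hE val_inj).
- move=> i; case vi: (v i) => [x|j].
    by have [z <-] := cov _ _ vi; exists (inl z).
  have jI : j \in [set j | exists i, v i = inr j] by apply/mem_set; exists i.
  by exists (inr (SigSub jI)).
Qed.

(** With the carrier as a parameter, all members of a chain live on one type and can be compared and
    united without transition maps. *)
Record str (T : Type) := Str {
  sU : set T; sV : set T; sp : T -> option T;
  sf : nat -> T -> T -> option T; sR : nat -> T -> T -> Prop }.

Definition str_L (T : Type) (s : str T) : Lstructure :=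
  @LStructure T (sU s) (sV s) (sp s) (sf s) (sR s).

(** [B] is transported along [r] by means of the partial inverse [inv]. Outside the range of [r] no
    predicate holds and no function is defined. *)
Lemma push_forward (B : Lstructure) (T : Type) (r : B -> T) : full B -> injective r ->
  exists s : str T, embedding (r : B -> str_L s) /\
    forall x, @supp (str_L s) x <-> exists b, r b = x.
Proof.
move=> fB rI.
pose inv x := if pselect (exists b, r b = x) is left e
  then Some (projT1 (cid e)) else None.
have invr b : inv (r b) = Some b.
  rewrite /inv; case: pselect => [e|[]]; last by exists b.
  by case: (cid e) => b' /= /rI ->.
pose s := @Str T (r @` inU B) (r @` inV B) (fun x => omap r (obind (@fp B) (inv x)))
  (fun n x y => omap r (obind (fun a => obind (fun b => ff n a b) (inv y)) (inv x)))
  (fun n x y => exists a b, [/\ r a = x, r b = y & rR n a b]).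
have sUE b : sU s (r b) <-> inU B b by split=> [[b' ? /rI <-]|?] //; exists b.
have sVE b : sV s (r b) <-> inV B b by split=> [[b' ? /rI <-]|?] //; exists b.
exists s; split.
  split=> //.
  - by move=> x /=; rewrite invr.
  - by move=> n x y /=; rewrite !invr.
  - by move=> n x y; split=> [[a [b [/rI -> /rI ->]]]|rxy] //; exists x, y.
move=> x; split=> [[[b _ <-]|[b _ <-]]|[b <-]]; try by exists b.
by case: (fB b) => Hb; [left|right]; exists b.
Qed.

Lemma rich_push (B N : Lstructure) (r : B -> N) : rich B -> embedding r ->
  (forall x : N, supp x -> exists b, r b = x) -> locK N /\ extK N.
Proof.
move=> rB rE rS; split=> [n v vs|E F i k EK FK iE kE].
  have /choice[w wv] : forall i, exists b, r b = v i by move=> i; exact: rS.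
  have [E [h [EK hE cov]]] := rich_loc rB (v := w) (fun=> rich_full rB _).
  exists E, (r \o h); split=> //; first exact: embedding_comp.
  by move=> i; have [z zw] := cov i; exists z; rewrite /= zw.
have /choice[k0 k0k] : forall z, exists b, r b = k z.
  by move=> z; apply/rS/(embedding_supp kE)/K_full.
have k0E : embedding k0.
  by apply: (embedding_left rE); rewrite (_ : r \o k0 = k) //; exact/funext.
have [k' k'E k'i] := rich_ext rB EK FK iE k0E.
by exists (r \o k'); [exact: embedding_comp|move=> x; rewrite /= k'i].
Qed.

(** * Extension of structures on a fixed carrier, and unions of chains *)

Section Extensions.
Variable T : Type.
Implicit Types s : str T.

Definition spt s : set T := @supp (str_L s).

(* Outside its support, a structure on [T] carries junk that [sle] ignores. *)
Record sle s s' : Prop := Sle {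
  sle_U : forall x, spt s x -> (sU s' x <-> sU s x);
  sle_V : forall x, spt s x -> (sV s' x <-> sV s x);
  sle_p : forall x, spt s x -> sp s' x = sp s x;
  sle_f : forall n x y, spt s x -> spt s y -> sf s' n x y = sf s n x y;
  sle_R : forall n x y, spt s x -> spt s y -> (sR s' n x y <-> sR s n x y) }.

Lemma sle_refl s : sle s s. Proof. by []. Qed.

Lemma sle_spt s s' : sle s s' -> spt s `<=` spt s'.
Proof.
move=> ss' x sx; move: (sx) => [xU|xV]; first by left; exact/(sle_U ss' sx).
by right; exact/(sle_V ss' sx).
Qed.

Lemma sle_trans s s' s'' : sle s s' -> sle s' s'' -> sle s s''.
Proof.
move=> ss' s's''; have sub := sle_spt ss'; split.
- by move=> x sx; rewrite (sle_U s's'' (sub _ sx)) (sle_U ss' sx).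
- by move=> x sx; rewrite (sle_V s's'' (sub _ sx)) (sle_V ss' sx).
- by move=> x sx; rewrite (sle_p s's'' (sub _ sx)) (sle_p ss' sx).
- by move=> n x y sx sy;
    rewrite (sle_f s's'' n (sub _ sx) (sub _ sy)) (sle_f ss' n sx sy).
- by move=> n x y sx sy;
    rewrite (sle_R s's'' n (sub _ sx) (sub _ sy)) (sle_R ss' n sx sy).
Qed.

Lemma sle_embedding s s' (E : Lstructure) (h : E -> T) : sle s s' ->
  (forall z, spt s (h z)) ->
  embedding (h : E -> str_L s') <-> embedding (h : E -> str_L s).
Proof.
move=> ss' hs; split=> -[hI hU hV hp hf hR]; split=> //=.
- by move=> x; rewrite -(sle_U ss' (hs x)); exact: hU.
- by move=> x; rewrite -(sle_V ss' (hs x)); exact: hV.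
- by move=> x; rewrite -(sle_p ss' (hs x)); exact: hp.
- by move=> n x y; rewrite -(sle_f ss' n (hs x) (hs y)); exact: hf.
- by move=> n x y; rewrite -(sle_R ss' n (hs x) (hs y)); exact: hR.
- by move=> x; rewrite (sle_U ss' (hs x)); exact: hU.
- by move=> x; rewrite (sle_V ss' (hs x)); exact: hV.
- by move=> x; rewrite (sle_p ss' (hs x)); exact: hp.
- by move=> n x y; rewrite (sle_f ss' n (hs x) (hs y)); exact: hf.
- by move=> n x y; rewrite (sle_R ss' n (hs x) (hs y)); exact: hR.
Qed.

Lemma embedding_spt s (E : Lstructure) (h : E -> str_L s) : inK E ->
  embedding h -> forall z, spt s (h z).
Proof. by move=> EK hE z; apply/(embedding_supp hE)/K_full. Qed.

(** Each clause of [sle] concerns at most two points of the support, and these lie in a common copy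
    of a member of K. *)
Lemma locK_sle s s' : locK (str_L s) ->
  (forall (E : Lstructure) (h : E -> T), inK E ->
    embedding (h : E -> str_L s) -> embedding (h : E -> str_L s')) ->
  sle s s'.
Proof.
move=> Ls H.
have H2 x y : spt s x -> spt s y -> exists (E : Lstructure) (h : E -> T) a b,
    [/\ embedding (h : E -> str_L s), embedding (h : E -> str_L s'), h a = x & h b = y].
  move=> sx sy; have [i|E [h [EK hE cov]]] := Ls 2 (vcons x (vcons y (@vnil T))).
    case: (unliftP ord0 i) => [j ->|->]; last by rewrite vcons0.
    rewrite vconsS; case: (unliftP ord0 j) => [[]//|->]; by rewrite vcons0.
  have [a] := cov ord0; have [b] := cov (lift ord0 ord0).
  rewrite vconsS !vcons0 => hb ha; exists E, h, a, b; split=> //; exact: H.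
split.
- move=> x sx; have [E [h [a [_ [hE h'E <- _]]]]] := H2 x x sx sx.
  by rewrite [X in X <-> _](emb_U h'E a) [X in _ <-> X](emb_U hE a).
- move=> x sx; have [E [h [a [_ [hE h'E <- _]]]]] := H2 x x sx sx.
  by rewrite [X in X <-> _](emb_V h'E a) [X in _ <-> X](emb_V hE a).
- move=> x sx; have [E [h [a [_ [hE h'E <- _]]]]] := H2 x x sx sx.
  by have := emb_fp h'E a; have := emb_fp hE a => /= -> ->.
- move=> n x y sx sy; have [E [h [a [b [hE h'E <- <-]]]]] := H2 x y sx sy.
  by have := emb_ff h'E n a b; have := emb_ff hE n a b => /= -> ->.
- move=> n x y sx sy; have [E [h [a [b [hE h'E <- <-]]]]] := H2 x y sx sy.
  by rewrite [X in X <-> _](emb_rR h'E n a b) [X in _ <-> X](emb_rR hE n a b).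
Qed.

Section ChainUnion.
Variable F : set (str T).
Hypothesis Ftot : total_on F sle.

(** Any member of the chain whose support contains the arguments may supply the value; comparability
    makes the choice immaterial. *)
Definition union_str : str T := @Str T
  [set x | exists2 s, F s & sU s x] [set x | exists2 s, F s & sV s x]
  (fun x => if pselect (exists s, F s /\ spt s x) is left e
            then sp (projT1 (cid e)) x else None)
  (fun n x y => if pselect (exists s, [/\ F s, spt s x & spt s y]) is left e
            then sf (projT1 (cid e)) n x y else None)
  (fun n x y => exists s, [/\ F s, spt s x, spt s y & sR s n x y]).

Lemma sle_union s : F s -> sle s union_str.
Proof.
move=> Fs; split.
- move=> x sx; split=> [[s' Fs' xU]|]; last by exists s.
  have [ss'|s's] := Ftot Fs Fs'; first exact/(sle_U ss' sx).
  by apply/(sle_U s's) => //; left.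
- move=> x sx; split=> [[s' Fs' xV]|]; last by exists s.
  have [ss'|s's] := Ftot Fs Fs'; first exact/(sle_V ss' sx).
  by apply/(sle_V s's) => //; right.
- move=> x sx /=; case: pselect => [e|[]]; last by exists s.
  case: (cid e) => s' [Fs' s'x] /=.
  by have [ss'|s's] := Ftot Fs Fs'; [rewrite (sle_p ss')|rewrite (sle_p s's)].
- move=> n x y sx sy /=; case: pselect => [e|[]]; last by exists s.
  case: (cid e) => s' [Fs' s'x s'y] /=.
  by have [ss'|s's] := Ftot Fs Fs'; [rewrite (sle_f ss')|rewrite (sle_f s's)].
- move=> n x y sx sy; split=> [[s' [Fs' s'x s'y r]]|r]; last by exists s.
  by have [ss'|s's] := Ftot Fs Fs'; [apply/(sle_R ss')|apply/(sle_R s's)].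
Qed.

Lemma spt_union x : spt union_str x <-> exists2 s, F s & spt s x.
Proof.
split=> [[[s Fs xU]|[s Fs xV]]|[s Fs sx]].
- by exists s => //; left.
- by exists s => //; right.
- exact: (sle_spt (sle_union Fs)).
Qed.

Lemma chain_tuple n (v : 'I_n -> T) : F !=set0 -> (forall i, spt union_str (v i)) ->
  exists2 s, F s & forall i, spt s (v i).
Proof.
move=> [s0 Fs0]; elim: n v => [|n IH] v vs; first by exists s0 => // -[].
have [s Fs sv] := IH (v \o lift ord0) (fun i => vs _).
have [s' Fs' s'v] := (spt_union _).1 (vs ord0).
have [ss'|s's] := Ftot Fs Fs'.
  exists s' => // i; case: (unliftP ord0 i) => [j ->|-> //].
  exact/(sle_spt ss')/sv.
exists s => // i; case: (unliftP ord0 i) => [j ->|->]; first exact: sv.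
exact: (sle_spt s's).
Qed.

Lemma union_locK_extK : F !=set0 ->
  (forall s, F s -> locK (str_L s) /\ extK (str_L s)) ->
  locK (str_L union_str) /\ extK (str_L union_str).
Proof.
move=> F0 FK; split=> [n v vs|E G i k EK GK iE kE].
  have [s Fs sv] := chain_tuple F0 vs.
  have [E [h [EK hE cov]]] := (FK s Fs).1 n v sv.
  exists E, h; split=> //; apply/(sle_embedding (sle_union Fs)) => //.
  exact: embedding_spt hE.
have [m [e eE]] := K_enum EK.
have [|s Fs sk] := @chain_tuple m (k \o e) F0.
  by move=> j; exact: embedding_spt kE _.
have ks z : spt s (k z) by have [j <-] := eE z; exact: sk.
have [k' k'E k'i] := (FK s Fs).2 E G i k EK GK iE
  ((sle_embedding (sle_union Fs) ks).1 kE).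
exists k' => //; apply/(sle_embedding (sle_union Fs)) => //.
exact: embedding_spt k'E.
Qed.

End ChainUnion.

End Extensions.

(** * Growing a rich structure by countable layers *)

Section Uncountable.
Variable B : Lstructure.
Hypotheses (rB : rich B) (Bc : countable [set: B]).

(** With infinitely many isolated points of V added, [s] is still locally in K and maps into [B].
    Transporting [B] back to [T], with the image of [s] returned to its place and everything else
    spread over [Z], gives the extension; the added points provide a point of V in [Z]. *)
Lemma extension (T : Type) (s : str T) (Z : set T) :
  locK (str_L s) -> countable (spt s) -> Z #= [set: nat] ->
  (forall x, Z x -> ~ spt s x) ->
  exists s' : str T, [/\ sle s s', locK (str_L s') /\ extK (str_L s'),
    forall x, spt s' x <-> (spt s x \/ Z x) & exists2 z, Z z & sV s' z].
Proof.
move=> Ls sc Znat Zs; pose M := addV (str_L s) nat.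
have ML : locK M by exact: locK_addV.
have Mc : countable (@supp M).
  apply: (sub_countable (B := inl @` spt s `|` range inr)).
    apply: subset_card_le => -[x|j] Hx; last by right; exists j.
    by left; exists x.
  rewrite -bigcup2E; apply: bigcup_countable => // -[|[|i]] _ //=.
    exact: sub_countable (card_image_le _ _) sc.
  apply: sub_countable (card_image_le _ _) _; exact: countableP.
have [b0 _] := infinite_setN0 (rich_infiniteV rB).
have [e eE] := forth_map ML (rich_ext rB) b0 Mc.
have eI x y : @supp M x -> @supp M y -> e x = e y -> x = y.
  move=> xs ys; have [i|E [h [EK hE cov]]] := ML 2 (vcons x (vcons y (@vnil M))).
    case: (unliftP ord0 i) => [j ->|->]; last by rewrite vcons0.
    rewrite vconsS; case: (unliftP ord0 j) => [[]//|->]; by rewrite vcons0.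
  have [a] := cov ord0; have [b] := cov (lift ord0 ord0).
  rewrite vconsS !vcons0 => <- <- /(emb_inj (eE E h EK hE)) -> //.
have eV j : inV B (e (inr j)).
  have [i|E [h [EK hE /(_ ord0)[z zj]]]] := ML 1 (fun=> inr j); first by right.
  by rewrite -zj; apply/(emb_V (eE E h EK hE)); apply/(emb_V hE); rewrite zj.
(* The part of [B] outside the image of [s]; the images of the added points make it infinite. *)
pose G := ~` [set e (inl x) | x in spt s].
have Ginr j : G (e (inr j)).
  by move=> [x sx exj]; have := eI (inl x) (inr j) sx (or_intror I) exj.
have Gnat : G #= [set: nat].
  apply: eq_card_nat; first exact: sub_countable (card_leT _) Bc.
  apply/infiniteP; have H : {in [set: nat] &, injective (fun j => e (inr j))}.
    by move=> i j _ _ eij; have [] := eI (inr i) (inr j) (or_intror I) (or_intror I) eij.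
  rewrite -(card_le_eql (inj_card_eq H)); apply: subset_card_le => _ [j _ <-].
  exact: Ginr.
have Z0 : Z !=set0.
  apply: infinite_setN0; rewrite (eq_finite_set Znat); exact: infinite_nat.
have [g [gZ gI gS]] : exists g : B -> T, [/\ forall b, Z (g b),
    forall a b, G a -> G b -> g a = g b -> a = b
    & forall z, Z z -> exists2 b, G b & g b = z].
  by apply: card_eq_fun => //; rewrite (card_eq_trans Gnat)// card_eq_sym.
(* [r] undoes [e] on the image of [s] and follows [g] elsewhere. *)
have /choice[r rP] : forall b, exists t, (exists x, [/\ spt s x, e (inl x) = b & t = x])
    \/ (G b /\ t = g b).
  move=> b; have [Gb|/contrapT[x sx xb]] := pselect (G b); first by exists (g b); right.
  by exists x; left; exists x.
have rI : injective r.
  move=> a b; case: (rP a) (rP b) => [[x [sx <- ->]]|[Ga ->]] [[y [sy <- ->]]|[Gb ->]].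
  - by move=> ->.
  - by move=> xg; case: (Zs _ (gZ b)); rewrite -xg.
  - by move=> xg; case: (Zs _ (gZ a)); rewrite xg.
  - exact: gI.
have rinl x : spt s x -> r (e (inl x)) = x.
  move=> sx; case: (rP (e (inl x))) => [[y [sy exy ->]]|[Gx _]].
    by have [] := eI (inl y) (inl x) sy sx exy.
  by case: Gx; exists x.
have rG b : G b -> r b = g b.
  by move=> Gb; case: (rP b) => [[x [sx xb _]]|[]//]; case: Gb; exists x.
have [s' [rE s'r]] := push_forward (rich_full rB) rI.
exists s'; split.
- apply: locK_sle => // E h EK hE.
  have hs := embedding_spt EK hE.
  have := embedding_comp rE (eE E _ EK (embedding_comp (embedding_addV _ nat) hE)).
  by rewrite (_ : r \o (e \o (inl \o h)) = h) //; apply/funext => z; rewrite /= rinl.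
- by apply: rich_push rE _ => // x /s'r.
- move=> x; rewrite [spt _ _]s'r; split=> [[b <-]|[sx|/gS[b Gb <-]]].
  + by case: (rP b) => [[y [sy _ ->]]|[_ ->]]; [left|right].
  + by exists (e (inl x)); rewrite rinl.
  + by exists b; rewrite rG.
- exists (r (e (inr 0))); first by rewrite rG//; exact: gZ.
  exact: (iffRL (emb_V rE (e (inr 0))) (eV 0)).
Qed.

Section Layers.
Variables (W : Type) (R : rel W).
Hypothesis WR : is_omega1 R.

(** The support consists of the layers {w} x nat over an initial segment [D]. The last clause puts a
    point of V in every layer, so that V ends up at least as large as [W]. *)
Definition layered (s : str (W * nat)) (D : set W) : Prop :=
  [/\ forall v w, D w -> R v w -> D v, forall x, spt s x <-> D x.1
    & forall w, D w -> exists n, sV s (w, n)].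

(** The new layer is placed at the least [w] outside [D]. All of [D] lies below [w], so the support
    so far is countable, as [extension] requires. *)
Lemma layered_grow s D : locK (str_L s) -> layered s D -> D <> setT ->
  exists s' D', [/\ sle s s', locK (str_L s') /\ extK (str_L s'), layered s' D'
    & exists2 w, D' w & ~ D w].
Proof.
move=> Ls [Dlow sD DV] DT; have [wo Wunc Wc] := WR.
have [|w nDw wmin] := wo_min wo (S := ~` D).
  by apply/set0P; apply: contra_notN DT => /eqP /(congr1 setC); rewrite setCK setC0.
have DR v : D v -> R v w.
  move=> Dv; have [//|wv] := wo_total wo v w.
  by case: nDw; exact: Dlow wv.
have sc : countable (spt s).
  apply: (sub_countable (B := [set v | R v w] `*` [set: nat])).
    by apply: subset_card_le => x /sD Dx; split=> //=; exact: DR.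
  by apply: countableX => //; exact: countableP.
pose Z := range (fun n : nat => (w, n)).
have Znat : Z #= [set: nat] by apply: inj_card_eq => a b _ _ [].
have [_ [n _ <-] /sD //|s' [ss' LX s'E [_ [m _ <-] mV]]] := extension Ls sc Znat.
exists s', (D `|` [set w]); split=> //; last by exists w => //; right.
split.
- move=> v u [Du vu|-> vw]; first by left; exact: Dlow vu.
  have [Dv|nDv] := pselect (D v); first by left.
  by right; apply: (wo_anti wo vw); exact: wmin.
- move=> [v n]; rewrite s'E sD; split=> [[Dv|[k _ [<- _]]]|[Dv|/= ->]].
  + by left.
  + by right.
  + by left.
  + by right; exists n.
- move=> v [/[dup] Dv /DV[n nV]|->]; last by exists m.
  by exists n; apply/(sle_V ss') => //; apply/sD.
Qed.

(* A Zorn-maximal union of countable layers [{w} * nat] exhausts [W * nat]: a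
   proper initial segment of layers is countable, hence embeds into [B] with
   infinite complement. *)
Lemma uncountable_rich : exists2 M : str (W * nat), rich (str_L M) &
  forall w, exists n, sV M (w, n).
Proof.
have [wo Wunc Wc] := WR.
have W0 : set0 <> [set: W] by move=> W0; apply: Wunc; rewrite -W0; exact: countable0.
pose good (s : str (W * nat)) :=
  (locK (str_L s) /\ extK (str_L s)) /\ exists D, layered s D.
have [s0 gs0] : exists s, good s.
  pose e : str (W * nat) := Str set0 set0 (fun=> None) (fun _ _ _ => None)
    (fun _ _ _ => False).
  have eL : locK (str_L e).
    move=> n v vs; exists emptyL, (fun x => of_void _ x); split.
    - exact: inK_empty.
    - exact: embedding_empty.
    - by move=> i; case: (vs i).
  (* The empty structure satisfies [locK] but not [extK], so the chain starts after one layer has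
     been grown on it. *)
  have [|s' [D' [_ LX lay _]]] := layered_grow eL _ W0.
    by split=> // x; split=> // -[].
  by exists s'; split=> //; exists D'.
pose Q : rel {s | good s} := fun s t => `[< sle (sval s) (sval t) >].
have [|||[s [[Ls Xs] [D lay]]] smax] := @ZL_preorder _ (exist _ s0 gs0) Q.
- by move=> t; apply/asboolP; exact: sle_refl.
- by move=> r s t /asboolP rs /asboolP st; apply/asboolP; exact: sle_trans st.
- move=> F Ftot; have [F0|nF] := pselect (F !=set0); last first.
    by exists (exist _ s0 gs0) => s Fs; case: nF; exists s.
  pose F' := sval @` F.
  have F'tot : total_on F' (@sle _).
    by move=> _ _ [s Fs <-] [t Ft <-]; case: (Ftot _ _ Fs Ft) => /asboolP; [left|right].
  have F'0 : F' !=set0 by case: F0 => s Fs; exists (sval s), s.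
  have gF s : F' s -> good s by move=> [t _ <-]; exact: (svalP t).
  have gu : good (union_str F').
    split; first by apply: union_locK_extK => // s /gF[].
    exists [set w | exists s D, [/\ F' s, layered s D & D w]]; split.
    - move=> v w [s [D [Fs lay Dw]]] vw; exists s, D; split=> //.
      by case: lay => low _ _; exact: low vw.
    - move=> x; rewrite (spt_union F'tot); split=> [[s Fs sx]|[s [D [Fs [_ sD _] Dx]]]].
        have [_ [D lay]] := gF _ Fs; exists s, D; split=> //.
        by case: lay => _ sD _; apply/sD.
      by exists s => //; apply/sD.
    - move=> w [s [D [Fs [_ _ DV] /DV[n nV]]]]; exists n.
      by exists s.
  exists (exist _ _ gu) => s Fs; apply/asboolP; apply: sle_union => //.
  by exists s.
have [DT|DT] := pselect (D = setT); last first.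
  have [s' [D' [ss' LX lay' [w D'w nDw]]]] := layered_grow Ls lay DT.
  have gs' : good s' by split=> //; exists D'.
  have /asboolP s's := smax (exist _ s' gs') (asboolT ss').
  case: nDw; have [_ sD _] := lay; have [_ s'D _] := lay'.
  by apply/(sD (w, 0))/(sle_spt s's)/s'D.
have [_ sD DV] := lay; exists s; last by move=> w; apply: DV; rewrite DT.
by split=> // x; apply/sD; rewrite DT.
Qed.

End Layers.

(** For countable [A] the structure [B] itself serves, with an injection if [A] is finite and a
    bijection onto its V otherwise. For uncountable [A] the layered structure is taken, and its V is
    shown to have the cardinality of [A]. *)
Lemma atomic_target (T : Type) (A : set T) : card_le_aleph1 A ->
  exists (M : Lstructure) (c : A -> M), [/\ rich M, forall a, inV M (c a), injective c
    & finite_set [set: A] \/ forall y, inV M y -> exists a, c a = y].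
Proof.
move=> [W [R [WR AW]]].
have AE : [set: A] #= A by exact: card_setT.
have [Afin|Ainf] := pselect (finite_set [set: A]).
  have [f [fV fI]] := finite_inj Afin (rich_infiniteV rB).
  by exists B, f; split=> //; [move=> a b; exact: fI|left].
suff [M [rM AM]] : exists M, rich M /\ [set: A] #= inV M.
  have [f [fV fI fS]] := card_eq_fun (infinite_setN0 (rich_infiniteV rM)) AM.
  exists M, f; split=> //; first by move=> a b; exact: fI.
  by right=> y /fS[a _ <-]; exists a.
have [Ac|Aunc] := pselect (countable [set: A]).
  exists B; split=> //; rewrite (card_eq_trans (eq_card_nat Ac Ainf))// card_eq_sym.
  apply: eq_card_nat; last exact: rich_infiniteV.
  exact: sub_countable (card_leT _) Bc.
have [M rM MV] := uncountable_rich WR.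
exists (str_L M); split=> //; rewrite card_eq_le; apply/andP; split.
  rewrite (card_le_eql AE); apply: card_le_trans AW _.
  have /choice[n nV] := MV.
  have H : {in [set: W] &, injective (fun w => (w, n w))} by move=> v w _ _ [].
  rewrite -(card_le_eql (inj_card_eq H)); apply: subset_card_le => _ [w _ <-].
  exact: nV.
(* V is contained in [W * nat], of size aleph_1, which embeds in every uncountable set and so in
   [A]. *)
apply: card_le_trans (card_leT _) _.
have [f [_ fI]] := omega1_le (omega1_lexnat WR) Aunc.
have H : {in [set: W * nat] &, injective f} by move=> v w _ _; exact: fI.
by rewrite -(card_le_eql (inj_card_eq H)); exact: card_leT.
Qed.

End Uncountable.

Theorem theorem4 (B : Lstructure) (hB : K_generic B)
    (C : Lstructure) (hC : models0 C (Th0 B))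
    (A : set C) (hA : A `<=` inV C) :
  [/\ indiscernible A,
      principal_types_dense (ThA A)
    & (exists (M : Lstructure) (c : A -> M), atomic_model (ThA A) c) <->
      card_le_aleph1 A].
Proof.
have rB := generic_rich hB; have Bc := gen_countable hB.
split; [exact: indiscernible_Vset rB hC _ hA|exact: dense_over rB hC hA Bc|split].
  move=> [M [c at_c]]; have cM := at_c.1.
  have [W [R [WR XW]]] : card_le_aleph1 (inU M).
    apply: (@free_le_aleph1 _ _ (fun x y => cl [set x; y])) => [x y _ _|x y z].
      exact: (atomic_cl_finite rB hC hA cM at_c).
    exact: (atomic_triple rB hC hA cM at_c).
  exists W, R; split=> //; apply: card_le_trans XW.
  (* A choice of preimages under p of the named points injects [A] into U. *)
  have /choice[u uP] : forall a : A, exists x, inU M x /\ fp x = Some (c a).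
    by move=> a; have [x] := ThA_fp_onto rB hC hA cM a; exists x.
  have uI : {in [set: A] &, injective u}.
    move=> a b _ _ uab; apply: (ThA_inj cM).
    by have := (uP a).2; rewrite uab (uP b).2 => -[].
  rewrite -(card_le_eql (card_setT A)) -(card_le_eql (inj_card_eq uI)).
  by apply: subset_card_le => _ [a _ <-]; exact: (uP a).1.
move=> /(atomic_target rB Bc)[M [c [rM cV cI fin]]].
by exists M, c; exact: (rich_atomic rB hC hA).
Qed.
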